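(* Let $\alpha > 0$ be fixed. For connected graphs $G$ with $n$ vertices whose minimum degree $\delta$ is at least $\alpha n$, set $\beta(G) = s_{n-1}(G)/s_n(G)$. Then, as $n \to \infty$, for nonnegative integers $k = o(n^{1/3})$, $$\frac{s_{n-k}(G)}{s_n(G)} = \frac{1}{k!}\, \beta(G)^{k} \big(1+O(kn^{-1/3})\big),$$ with an error term that is uniform in $k$ for $k \leq n^{1/3-\epsilon}$ if $\epsilon > 0$ is fixed. Explicitly: (i) for every sequence of nonnegative integers $k = k(n)$ with $k(n)/n^{1/3} \to 0$ there are constants $A > 0$ and $n_0$ (depending only on $\alpha$ and the sequence) such that for all $n \geq n_0$ and every connected graph $G$ with $n$ vertices and minimum degree at least $\alpha n$, $$\left| \frac{s_{n-k}(G)}{s_n(G)} - \frac{\beta(G)^k}{k!} \right| \leq A\, k\, n^{-1/3}\, \frac{\beta(G)^k}{k!};$$ (ii) for every fixed $\epsilon > 0$ there are constants $A > 0$ and $n_0$ (depending only on $\alpha$ and $\epsilon$) such that the same inequality holds for all $n \geq n_0$, every such $G$, and all integers $k$ with $0 \leq k \leq n^{1/3-\epsilon}$.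
   Context: Graphs are finite and simple. A subtree of a graph $G$ is any (not necessarily induced) subgraph of $G$ that is a tree (with at least one vertex). For a graph $G$ with $n$ vertices and a positive integer $k \leq n$, $s_k(G)$ denotes the number of subtrees of $G$ with exactly $k$ vertices; in particular $s_n(G)$ is the number of spanning trees of $G$. *)

(* Defs.v *)
From mathcomp Require Import all_boot all_order all_algebra.
From mathcomp Require Import boolp reals exp.
Import Order.TTheory GRing.Theory Num.Theory.

Set Implicit Arguments.
Unset Strict Implicit.
Unset Printing Implicit Defensive.

Local Open Scope ring_scope.

Record sgraph := SGraph {
  vertex :> finType;
  adj : rel vertex;
  adj_sym : symmetric adj;
  adj_irrefl : irreflexive adj
}.

Definition degree (G : sgraph) (x : G) : nat := #|[set y : G | adj x y]|.

(* Degrees are smaller than #|G|, so the default value #|G| of the minimum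
   is only reached on the empty graph. *)
Definition min_degree (G : sgraph) : nat :=
  \big[minn/#|G|]_(x : G) degree x.

Definition edge_set (G : sgraph) : {set {set G}} :=
  [set e : {set G} | [exists x : G, exists y : G,
                        adj x y && (e == [set x; y]%SET)]].

(* The relation r connects the vertices of W; the null graph does not count as
   connected. *)
Definition connected_on (T : finType) (W : {set T}) (r : rel T) : Prop :=
  (0 < #|W|)%N /\ {in W &, forall x y, connect r x y}.

(* For a symmetric irreflexive r: a repetition-free closed walk on at least three
   vertices is a cycle, while one on two vertices is a single edge traversed in
   both directions. *)
Definition acyclic (T : finType) (r : rel T) : Prop :=
  forall c : seq T, uniq c -> cycle r c -> (size c <= 2)%N.

Definition connected_graph (G : sgraph) : Prop :=
  connected_on [set: G]%SET (@adj G).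

Definition edge_rel (T : finType) (F : {set {set T}}) : rel T :=
  fun x y => [set x; y]%SET \in F.

(* A subgraph is a pair (W, F) of a vertex set and an edge set. *)
Definition is_subgraph (G : sgraph) (H : {set G} * {set {set G}}) : Prop :=
  H.2 \subset edge_set G /\ finset.cover H.2 \subset H.1.

Definition is_subtree (G : sgraph) (H : {set G} * {set {set G}}) : Prop :=
  [/\ is_subgraph H, connected_on H.1 (edge_rel H.2) & acyclic (edge_rel H.2)].

Definition num_subtrees (G : sgraph) (k : nat) : nat :=
  #|[set H : {set G} * {set {set G}} | `[< is_subtree H >] & #|H.1| == k]|.

Definition beta (R : realType) (G : sgraph) : R :=
  (num_subtrees G #|G|.-1)%:R / (num_subtrees G #|G|)%:R.

(* The asymptotic estimate for s_(n-k)(G) / s_n(G), n being the order of G,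
   with the constant A in the error term. *)
Definition subtree_estimate (R : realType) (A : R) (G : sgraph) (k : nat)
    : Prop :=
  let n := #|G| in
  let main := beta R G ^+ k / k`!%:R in
  `| (num_subtrees G (n - k))%:R / (num_subtrees G n)%:R - main |
    <= A * k%:R * n%:R `^ (- 3^-1) * main.

(* Main.v *)
Require Import Defs.
From mathcomp Require Import all_boot all_order all_algebra.
From mathcomp Require Import perm boolp reals.
From mathcomp Require Import zify ring lra.
Import Order.TTheory GRing.Theory Num.Theory.

(* Write tau(W) for the number of trees with vertex set W, so that
   s_(n-k) = sum_(|S| = k) tau(V - S), and let T be a uniform spanning tree.
   As v is a leaf of d(v) tau(V - v) spanning trees, beta = E[X] with
   X = sum_(v leaf of T) 1 / d(v).

   Lower bound.  Counting the trees in which all of S are leaves, s_(n-k) / s_n is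
   at least the expectation of the k-th elementary symmetric polynomial of the
   weights 1 / d(v) of the leaves of T.  These weights are at most w = 1 / (alpha n),
   so k! times this polynomial is at least (X - k w)^k if X >= k w, and convexity
   gives k! s_(n-k) / s_n >= (beta - k w)^k.

   Upper bound.  (k+1) s_(n-k-1) = sum_(|S| = k) tau(V - S) beta(V - S), and deleting
   one vertex u increases beta by O(1 / n).  If u and v are not adjacent, then
   tau(W-u-v) tau(W) <= tau(W-u) tau(W-v): replacing all but one edge at u and at v,
   this becomes log-submodularity of spanning tree counts in the edge set, which
   follows from the matrix-tree theorem because c^T M^-1 c decreases in M.  For
   adjacent u and v there is an error term whose sum over v is at most a multiple of
   E[deg_T u] / n, and E[deg_T u] = O(1) by a switching argument.  Hence
   k! s_(n-k) / s_n <= (beta + O(k / n))^k.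

   Finally beta is bounded below: a linear expected number of leaves comes from
   another switching, which detaches one of the two neighbours of a vertex of
   degree 2. *)

Set Implicit Arguments.
Unset Strict Implicit.
Unset Printing Implicit Defensive.

Lemma set2_inj (T : finType) (a b x y : T) :
  [set a; b]%SET = [set x; y]%SET -> (a = x /\ b = y) \/ (a = y /\ b = x).
Proof.
move=> eq_ab; have in_xy z : z \in [set a; b]%SET = (z \in [set x; y]%SET).
  by rewrite eq_ab.
have := in_xy a; have := in_xy b; have := in_xy x; have := in_xy y.
rewrite !in_set2 !eqxx !orbT /=.
by do 2!(move/orP=> []/eqP ?); do 2!(move/esym/orP=> []/eqP ?); subst; auto.
Qed.

(** * Trees as acyclic parent maps *)

Section ParentMaps.

Variable T : finType.
Implicit Types (f g : {ffun T -> option T}) (x y z : T).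

(** The parent comes first, so that [well_founded (parent_of f)] says that every chain of parents
    ends, i.e. that [f] is a rooted forest. *)
Definition parent_of f y x : Prop := f x = Some y.

Inductive ancestor f : T -> T -> Prop :=
| ancestor_refl x : ancestor f x x
| ancestor_step x y z : f x = Some y -> ancestor f y z -> ancestor f x z.

Definition redirect f v (o : option T) : {ffun T -> option T} :=
  [ffun x => if x == v then o else f x].

Definition map_edges f : {set {set T}} :=
  [set e | [exists x, exists y, (f x == Some y) && (e == [set x; y]%SET)]]%SET.

Lemma mem_map_edges f x y :
  ([set x; y]%SET \in map_edges f) = (f x == Some y) || (f y == Some x).
Proof.
rewrite inE; apply/idP/orP.
  case/existsP=> a /existsP [b /andP[/eqP fa /eqP /set2_inj]].
  by case=> [[-> ->]|[-> ->]]; rewrite fa eqxx; [left|right].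
case=> /eqP h; apply/existsP.
  by exists x; apply/existsP; exists y; rewrite h !eqxx.
by exists y; apply/existsP; exists x; rewrite h setUC !eqxx.
Qed.

Lemma map_edgesP f e :
  reflect (exists x y, f x = Some y /\ e = [set x; y]%SET) (e \in map_edges f).
Proof.
rewrite inE; apply: (iffP existsP) => [[x /existsP[y /andP[/eqP ? /eqP ?]]]|].
  by exists x, y.
case=> x [y [fx ->]]; exists x; apply/existsP; exists y.
by rewrite fx !eqxx.
Qed.

Lemma ancestor_trans f x y z : ancestor f x y -> ancestor f y z -> ancestor f x z.
Proof.
by move=> h; elim: h z => // {}x {}y w fx _ IH z /IH; apply: ancestor_step.
Qed.

Lemma ancestor_edge f x y : f x = Some y -> ancestor f x y.
Proof. by move=> fx; apply: ancestor_step fx (ancestor_refl _ _). Qed.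

Lemma ancestor_parent f x y v :
  ancestor f x v -> f x = Some y -> x = v \/ ancestor f y v.
Proof. by case=> [|{}x z {}v -> ? [<-]]; [left|right]. Qed.

(** A directed cycle through [x] also passes through its parent, so well-founded induction excludes
    it. *)
Lemma parent_not_ancestor f x y :
  well_founded (parent_of f) -> f x = Some y -> ~ ancestor f y x.
Proof.
move=> wf; elim: {x}(wf x) y => x _ IH y fx anc.
have {}IH := IH y fx.
case: anc fx IH => [z fz|z y' w fz anc fw] IH.
  by apply: (IH z fz); constructor.
by apply: (IH _ fz); apply: ancestor_trans anc (ancestor_edge fw).
Qed.

(** In a forest this is one more than the depth of [x], as [x] counts itself. *)
Definition num_ancestors f x := #|[set y | `[< ancestor f x y >]]%SET|.

Lemma num_ancestors_parent f x y : well_founded (parent_of f) ->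
  f x = Some y -> (num_ancestors f y < num_ancestors f x)%N.
Proof.
move=> wf fx; apply/proper_card/properP; split.
  apply/subsetP=> z; rewrite !inE => /asboolP h.
  by apply/asboolP; apply: ancestor_step fx h.
exists x; rewrite !inE; first by apply/asboolP; constructor.
by apply/asboolP; apply: parent_not_ancestor.
Qed.

(** On a closed walk take a vertex with the most ancestors. Its neighbours on the walk cannot be its
    children, so both are its parent, and a repetition-free walk then has at most two vertices. *)
Lemma map_edges_acyclic f :
  well_founded (parent_of f) -> acyclic (edge_rel (map_edges f)).
Proof.
move=> wf c; case: c => // x0 c0; move: (x0 :: c0) (mem_head x0 c0) => c x0c uc cc {c0}.
have [x xc max_x] : exists2 x, x \in c
    & forall y, y \in c -> (num_ancestors f y <= num_ancestors f x)%N.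
  by case: (@arg_maxnP _ x0 (mem c) (num_ancestors f) x0c) => x; exists x.
have fxE y : y \in c -> edge_rel (map_edges f) x y -> f x = Some y.
  move=> yc; rewrite /edge_rel mem_map_edges => /orP[/eqP //|/eqP fy].
  by have := num_ancestors_parent wf fy; rewrite ltnNge max_x.
have [i p rotE] := rot_to xc.
have mem_p y : y \in p -> y \in c.
  by move=> yp; rewrite -(mem_rot i) rotE inE yp orbT.
move: uc cc; rewrite -(rot_cycle i) -(rot_uniq i) -(size_rot i) rotE.
case: p mem_p {rotE} => // y [//|z q] mem_p.
rewrite /cycle rcons_path => up /andP[/andP[xy _] lx].
have lE : f x = Some (last z q).
  apply: fxE; first by apply: mem_p; rewrite inE mem_last orbT.
  by move: lx; rewrite /edge_rel setUC.
have yE : f x = Some y by apply: fxE => //; apply: mem_p; rewrite inE eqxx.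
move: up; rewrite [uniq _]/= => /and3P[_ /negP yq _].
by case: yq; move: lE; rewrite yE => -[->]; apply: mem_last.
Qed.

Lemma redirectE f v o x : redirect f v o x = if x == v then o else f x.
Proof. by rewrite ffunE. Qed.

Lemma redirect_same f v o : redirect f v o v = o.
Proof. by rewrite redirectE eqxx. Qed.

Lemma redirect_other f v o x : x != v -> redirect f v o x = f x.
Proof. by rewrite redirectE => /negbTE ->. Qed.

Lemma redirectK f v o : redirect (redirect f v o) v (f v) = f.
Proof. by apply/ffunP=> x; rewrite !redirectE; case: eqP => // ->. Qed.

Lemma redirect_wf_None f v : well_founded (parent_of f) ->
  well_founded (parent_of (redirect f v None)).
Proof.
move=> wf x; elim: {x}(wf x) => x _ IH; constructor=> y par.
apply: IH; move: par; rewrite /parent_of redirectE.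
by case: (x =P v).
Qed.

(** Chains that do not meet [v] are unchanged, and [v] now continues along one of them. *)
Lemma redirect_wf f v x : well_founded (parent_of f) -> ~ ancestor f x v ->
  well_founded (parent_of (redirect f v (Some x))).
Proof.
move=> wf not_anc.
have acc_out y : ~ ancestor f y v -> Acc (parent_of (redirect f v (Some x))) y.
  elim: {y}(wf y) => y _ IH not_y; constructor=> z par.
  have [yv|yv] := eqVneq y v; first by case: not_y; rewrite yv; constructor.
  have {par}fy : f y = Some z by rewrite -par redirect_other.
  by apply: IH => // anc; apply: not_y; apply: ancestor_step fy anc.
move=> y; elim: {y}(wf y) => y _ IH; constructor=> z.
have [->|yv] := eqVneq y v; rewrite {1}/parent_of.
  by rewrite redirect_same => -[<-]; apply: acc_out.
by rewrite (redirect_other _ _ yv) => fy; apply: (IH z fy).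
Qed.

End ParentMaps.

(** * Trees as edge sets, and their rootings *)

Section Trees.

Variable T : finType.
Implicit Types (E F : {set {set T}}) (W S : {set T}) (f g : {ffun T -> option T}).
Implicit Types (x y z v r : T).

(** The cover condition discards the edges leaving [W], so a vertex is deleted by shrinking [W]
    while [E] stays fixed. *)
Definition trees E W : {set {set {set T}}} :=
  [set F : {set {set T}} | [&& F \subset E, finset.cover F \subset W &
    `[< connected_on W (edge_rel F) /\ acyclic (edge_rel F) >]]].

(* f maps r and the points outside W to None. *)
Definition rooted_on E W r f : Prop :=
  [/\ well_founded (parent_of f),
      forall x, (f x == None) = (x \notin W :\ r)
    & forall x y, f x = Some y -> y \in W /\ [set x; y] \in E].

Definition deg F v := #|[set e in F | v \in e]|.

Definition two_sets E := forall e, e \in E -> #|e| = 2.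

Definition nbrs E W v := [set y in W | [set v; y] \in E].

Lemma edge_rel_sym F : symmetric (edge_rel F).
Proof. by move=> x y; rewrite /edge_rel setUC. Qed.

Lemma edge_rel_connect_sym F : connect_sym (edge_rel F).
Proof. by apply: sym_connect_sym; apply: edge_rel_sym. Qed.

Lemma two_sets_neq E x y : two_sets E -> [set x; y] \in E -> x != y.
Proof. by move=> E2 /E2; rewrite cards2; case: eqP. Qed.

Lemma two_setsP E e : two_sets E -> e \in E -> exists x y, x != y /\ e = [set x; y].
Proof. by move=> E2 /E2 /eqP /cards2P [x [y [? ->]]]; exists x, y. Qed.

Lemma two_setsS E F : F \subset E -> two_sets E -> two_sets F.
Proof. by move=> /subsetP FE E2 e /FE; apply: E2. Qed.

Lemma nbrs_neq E W v y : two_sets E -> y \in nbrs E W v -> y != v.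
Proof. by move=> E2; rewrite inE eq_sym => /andP[_ /(two_sets_neq E2)]. Qed.

Lemma cover_edge F W x y : finset.cover F \subset W -> [set x; y] \in F -> x \in W.
Proof.
move=> /subsetP FW xyF; apply: FW; apply/bigcupP; exists [set x; y] => //.
exact: set21.
Qed.

Lemma rooted_root E W r f : rooted_on E W r f -> f r = None.
Proof. by case=> _ dom _; apply/eqP; rewrite dom !inE eqxx. Qed.

Lemma rooted_parent E W r f x :
  rooted_on E W r f -> x \in W -> x != r -> exists y, f x = Some y.
Proof.
case=> _ dom _ xW xr; have := dom x; rewrite !inE xr xW /=.
by case: (f x) => // y _; exists y.
Qed.

Lemma rooted_dom E W r f x y : rooted_on E W r f -> f x = Some y -> x \in W /\ x != r.
Proof.
by case=> _ dom _ fx; have := dom x; rewrite fx !inE => /esym/negbFE/andP[].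
Qed.

Lemma rooted_ancestor E W r f x :
  rooted_on E W r f -> x \in W -> ancestor f x r.
Proof.
move=> rf; have [wf dom edg] := rf; elim: {x}(wf x) => x _ IH xW.
have [->|xr] := eqVneq x r; first by constructor.
have [y fx] := rooted_parent rf xW xr.
by apply: (ancestor_step fx); apply: IH => //; case: (edg _ _ fx).
Qed.

Lemma rooted_mono E E' W r f : E \subset E' -> rooted_on E W r f -> rooted_on E' W r f.
Proof.
by move=> /subsetP EE' [wf dom edg]; split=> // x y /edg[? /EE'].
Qed.

Lemma ancestor_connect f x y : ancestor f x y -> connect (edge_rel (map_edges f)) x y.
Proof.
elim=> [z|{}x z {}y fx _]; first exact: connect0.
by apply: connect_trans; apply: connect1; rewrite /edge_rel mem_map_edges fx eqxx.
Qed.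

Lemma rooted_trees E W r f : r \in W -> rooted_on E W r f -> map_edges f \in trees E W.
Proof.
move=> rW rf; have [wf dom edg] := rf; rewrite inE; apply/and3P; split.
- by apply/subsetP=> e /map_edgesP[x [y [/edg[_ ?] ->]]].
- apply/bigcupsP=> e /map_edgesP[x [y [fx ->]]]; apply/subsetP=> z.
  rewrite !inE => /orP[] /eqP ->; first by case: (rooted_dom rf fx).
  by case: (edg _ _ fx).
apply/asboolP; split; last exact: map_edges_acyclic.
split; first by apply/card_gt0P; exists r.
move=> x y xW yW; apply: (@connect_trans _ _ r).
  exact/ancestor_connect/(rooted_ancestor rf).
by rewrite edge_rel_connect_sym; apply/ancestor_connect/(rooted_ancestor rf).
Qed.

(** Breadth-first search: every vertex other than [r] takes as parent a neighbour closer to [r]. *)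
Lemma connected_rooted F W r : r \in W -> finset.cover F \subset W ->
  connected_on W (edge_rel F) -> exists f, rooted_on F W r f.
Proof.
move=> rW FW [_ conn].
(* Inside [W] this asks for a walk of length [n] from [x] to [r]. It is made true outside [W], so
   that a least [n], the distance, exists for every [x]. *)
pose Q x n := (x \notin W) ||
  `[< exists p, [/\ path (edge_rel F) x p, last x p = r & size p = n] >].
have exQ x : exists n, Q x n.
  have [xW|xW] := boolP (x \in W); last by exists 0; rewrite /Q xW.
  have /connectP[p px rE] := conn _ _ xW rW.
  by exists (size p); rewrite /Q xW; apply/asboolP; exists p.
have [d step] : exists d : T -> nat, forall x, x \in W -> x != r ->
    exists y, edge_rel F x y && (d y < d x)%N.
  exists (fun x => ex_minn (exQ x)) => x xW xr.
  case: (ex_minnP (exQ x)) => n; rewrite {1}/Q xW /=.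
  case/asboolP=> -[|y p] [/= px lp sz] _; first by rewrite lp eqxx in xr.
  case/andP: px => xy py; exists y; rewrite xy -sz ltnS /=.
  case: ex_minnP => m _; apply; rewrite /Q; apply/orP; right.
  by apply/asboolP; exists p.
pose f := [ffun x => if x \in W :\ r
                     then [pick y | edge_rel F x y && (d y < d x)%N] else None].
have fP x y : f x = Some y -> edge_rel F x y && (d y < d x)%N.
  by rewrite ffunE; case: ifP => // _; case: pickP => // z ? [<-].
exists f; split.
- suff wf n x : (d x < n)%N -> Acc (parent_of f) x by move=> x; apply: (wf (d x).+1).
  elim: n x => [x|n IH x dx]; first by rewrite ltn0.
  by constructor=> y /fP /andP[_ dy]; apply: IH; apply: leq_trans dy dx.
- move=> x; rewrite ffunE; case: ifP => // xWr; case: pickP => //= none.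
  move: xWr; rewrite !inE => /andP[xr xW]; have [y] := step x xW xr.
  by rewrite none.
- move=> x y /fP /andP[xy _]; split=> //.
  by apply: (@cover_edge F W y x) => //; rewrite setUC.
Qed.

(** A spanning parent map inside [F] uses every edge of [F]: a missing edge would close the path
    joining its ends to a cycle. *)
Lemma tree_rooted E W r F : two_sets E -> r \in W -> F \in trees E W ->
  exists2 f, rooted_on E W r f & map_edges f = F.
Proof.
move=> E2 rW; rewrite inE => /and3P[FE FW /asboolP[conn acyc]].
have [f rf] := connected_rooted rW FW conn.
exists f; first exact: rooted_mono rf.
have [wf dom edg] := rf.
have fF : map_edges f \subset F.
  by apply/subsetP=> e /map_edgesP[x [y [/edg[_ ?] ->]]].
apply/eqP; rewrite eqEsubset fF; apply/subsetP=> e eF.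
have [a [b [ab eE]]] := two_setsP (two_setsS FE E2) eF; rewrite {}eE in eF *.
apply: contraT => nab.
have aW : a \in W by apply: cover_edge FW eF.
have bW : b \in W by apply: (@cover_edge F W b a) => //; rewrite setUC.
have : connect (edge_rel (map_edges f)) a b.
  have := rooted_trees rW rf; rewrite inE => /and3P[_ _ /asboolP[[_ c] _]].
  exact: c.
case/connectP=> p0 path0 lp0; move: lp0; case/shortenP: path0 => p pathp up _ lp.
have sub : subrel (edge_rel (map_edges f)) (edge_rel F).
  by move=> x y; apply: (subsetP fF).
have := acyc (a :: p) up; rewrite /cycle rcons_path (sub_path sub pathp) /= -lp.
rewrite /edge_rel setUC eF => /(_ isT); rewrite ltnS.
(* The cycle has at most two vertices, so the path is the edge [ab] itself, which was assumed
   missing. *)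
case: p up lp pathp => [|y [|z q]] //= _ lp; first by rewrite lp eqxx in ab.
by rewrite -lp /edge_rel (negbTE nab).
Qed.

(** Induction from the root outwards: if [f] oriented the edge from [x] to its parent [y] in [g] the
    other way, then, as [f] and [g] agree at [y], [g] would have a cycle of length 2. *)
Lemma rooted_inj E W r f g : rooted_on E W r f -> rooted_on E W r g ->
  map_edges f = map_edges g -> f = g.
Proof.
move=> rf rg fg; have [wfg _ _] := rg.
suff eq_fg x : f x = g x by apply/ffunP.
elim: {x}(wfg x) => x _ IH.
have [//|neq_fg] := eqVneq (f x) (g x).
case gx : (g x) => [y|]; last first.
  have [_ domf _] := rf; have [_ domg _] := rg; apply/eqP.
  by rewrite domf -domg gx.
have : [set x; y] \in map_edges f by rewrite fg mem_map_edges gx eqxx.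
rewrite mem_map_edges => /orP[/eqP-> //|/eqP fy].
have gy : g y = Some x by rewrite -IH.
by case: (parent_not_ancestor wfg gx); apply: ancestor_edge.
Qed.

(** For a fixed root, trees correspond to parent maps. Edge switches then change a single value of
    the map, which makes them easy to invert. *)
Lemma card_trees_rooted E W r (P : pred {set {set T}}) : two_sets E -> r \in W ->
  #|[set F in trees E W | P F]| =
  #|[set f | `[< rooted_on E W r f >] & P (map_edges f)]|.
Proof.
move=> E2 rW.
rewrite -(@card_in_imset _ _ (@map_edges T)
  [set f | `[< rooted_on E W r f >] & P (map_edges f)]); last first.
  move=> f g; rewrite !inE => /andP[/asboolP rf _] /andP[/asboolP rg _].
  exact: rooted_inj rf rg.
apply: eq_card => F; rewrite inE; apply/andP/imsetP.
  case=> /(tree_rooted E2 rW)[f rf <-] Pf; exists f => //.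
  by rewrite inE Pf andbT; apply/asboolP.
case=> f; rewrite inE => /andP[/asboolP rf Pf] ->.
by split=> //; apply: rooted_trees rf.
Qed.

End Trees.

Lemma card_sum_pairs (I J : finType) (A : {set I}) (B : I -> {set J}) :
  \sum_(i in A) #|B i| = #|[set p : I * J | (p.1 \in A) && (p.2 \in B p.1)]|.
Proof.
rewrite -sum1dep_card -(pair_big_dep (mem A) (fun i j => j \in B i) (fun _ _ => 1)) /=.
by apply: eq_bigr => i _; rewrite sum1_card.
Qed.

(** * Pruning and attaching leaves *)

Section Leaves.

Variable T : finType.
Implicit Types (E F : {set {set T}}) (W S : {set T}) (f g : {ffun T -> option T}).
Implicit Types (x y z v r u : T).

(* Allowing degree 0 makes leafy stable under deletion of other leaves. *)
Definition leafy E W S := [set F in trees E W | [forall s in S, deg F s <= 1]].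

Lemma leafyP E W S F :
  reflect (F \in trees E W /\ forall s, s \in S -> deg F s <= 1) (F \in leafy E W S).
Proof.
apply: (iffP setIdP) => -[-> H]; split=> //; last exact/forall_inP.
by move=> s sS; apply: (forall_inP H).
Qed.

Lemma leafy0 E W : leafy E W set0 = trees E W.
Proof.
by apply/setP=> F; apply/leafyP/idP => [[]//|?]; split=> // s; rewrite inE.
Qed.

Lemma trees_ext E E' W : (forall e : {set T}, e \subset W -> (e \in E) = (e \in E')) ->
  trees E W = trees E' W.
Proof.
move=> EE'; apply/setP=> F; rewrite !inE.
have [FW|] := boolP (finset.cover F \subset W); last by rewrite !andbF.
congr (_ && _); have eW e : e \in F -> e \subset W.
  by move=> eF; apply: subset_trans FW; apply: bigcup_sup eF.
by apply/subsetP/subsetP=> FE e eF; [rewrite -EE'|rewrite EE']; auto.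
Qed.

Lemma degS F F' v : F \subset F' -> deg F v <= deg F' v.
Proof.
move=> /subsetP FF'; apply/subset_leq_card/subsetP=> e.
by rewrite !inE => /andP[/FF' -> ->].
Qed.

Lemma deg_root f v : f v = None ->
  deg (map_edges f) v = #|[set c | f c == Some v]|.
Proof.
move=> fv; rewrite /deg -(@card_in_imset _ _ (fun c => [set c; v])); last first.
  move=> c c'; rewrite !inE => /eqP fc _ /set2_inj [[]//|[cv _]].
  by move: fc; rewrite cv fv.
apply: eq_card => e; rewrite inE; apply/andP/imsetP; last first.
  case=> c; rewrite inE => fc ->.
  by rewrite mem_map_edges fc set22.
case=> /map_edgesP[x [y [fx ->]]]; rewrite !inE => /orP[] /eqP vE.
  by move: fx; rewrite -vE fv.
by exists x; [rewrite inE fx vE|rewrite vE].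
Qed.

Lemma deg_nonroot f v x y : well_founded (parent_of f) -> f v = Some y -> f x = Some v ->
  1 < deg (map_edges f) v.
Proof.
move=> wf fv fx; have neq : [set v; y] != [set x; v].
  apply/eqP=> /set2_inj[[_ vy]|[_ yx]].
    by case: (parent_not_ancestor wf fv); rewrite vy; constructor.
  by case: (parent_not_ancestor wf fx); apply: ancestor_edge; rewrite -yx.
have <- : #|[set [set v; y]; [set x; v]]| = 2 by rewrite cards2 neq.
apply/subset_leq_card/subsetP=> e; rewrite in_set2 => /orP[] /eqP->; rewrite in_set.
  by rewrite mem_map_edges fv eqxx set21.
by rewrite mem_map_edges fx eqxx set22.
Qed.

Lemma redirect_None_edges f v : map_edges (redirect f v None) \subset map_edges f.
Proof.
apply/subsetP=> e /map_edgesP[x [y []]]; rewrite redirectE; case: eqP => // _ fx ->.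
by rewrite mem_map_edges fx eqxx.
Qed.

Lemma rooted_del_leaf E W r f v : rooted_on E W r f -> v \in W -> v != r ->
  deg (map_edges f) v <= 1 -> rooted_on E (W :\ v) r (redirect f v None).
Proof.
move=> rf vW vr dv; have [wf dom edg] := rf.
have [y fv] := rooted_parent rf vW vr; split; first exact: redirect_wf_None.
  move=> x; rewrite redirectE; have [->|xv] := eqVneq x v.
    by rewrite !inE !eqxx andbF.
  by rewrite dom !inE xv.
move=> x z; rewrite redirectE; case: eqP => // _ fx; have [zW ->] := edg _ _ fx.
split=> //; rewrite !inE zW andbT; apply: contraTneq dv => zv.
by rewrite -ltnNge; apply: (deg_nonroot wf fv (x := x)); rewrite fx zv.
Qed.

Lemma rooted_no_child E W r g x v : rooted_on E W r g -> v \notin W -> g x != Some v.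
Proof.
by case=> _ _ edg vW; apply/eqP=> /edg[]; rewrite (negbTE vW).
Qed.

Lemma rooted_add_leaf E W r g v y : rooted_on E (W :\ v) r g -> v \in W -> v != r ->
  y \in nbrs E W v -> y != v -> rooted_on E W r (redirect g v (Some y)).
Proof.
move=> rg vW vr; rewrite inE => /andP[yW vyE] yv; have [wf dom edg] := rg.
have nov x : g x != Some v by apply: (rooted_no_child x rg); rewrite !inE eqxx.
have anc_v x w : ancestor g x w -> w = v -> x = v.
  by elim=> // {}x z {}w gx _ IH wv; have := nov x; rewrite gx IH // eqxx.
split.
- by apply: redirect_wf => // /anc_v yvE; rewrite yvE ?eqxx in yv.
- move=> x; rewrite redirectE; have [->|xv] := eqVneq x v.
    by rewrite !inE vr vW.
  by rewrite dom !inE xv.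
move=> x z; rewrite redirectE; have [->[<-]//|_ /edg] := eqVneq x v.
by rewrite !inE => -[/andP[]].
Qed.

Lemma deg_add_leaf E W r g v y : rooted_on E (W :\ v) r g ->
  deg (map_edges (redirect g v (Some y))) v <= 1.
Proof.
move=> rg; have nov x : g x != Some v by apply: (rooted_no_child x rg); rewrite !inE eqxx.
rewrite -(cards1 [set v; y]); apply/subset_leq_card/subsetP=> e.
rewrite inE => /andP[/map_edgesP[x [z [+ ->]]]].
rewrite redirectE; have [->[<-] _|xv gx] := eqVneq x v; first by rewrite inE.
rewrite !inE [v == x]eq_sym (negbTE xv) /= => /eqP zv.
by have := nov x; rewrite gx zv eqxx.
Qed.

(** A tree is recovered from the neighbour of its leaf [v] and the tree without [v]. This gives only
    an upper bound, since attaching [v] may raise a degree in [S]. *)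
Lemma card_leafy_del E W S r v : two_sets E -> v \in W -> r \in W -> r != v ->
  #|leafy E W (v |: S)| <= #|nbrs E W v| * #|leafy E (W :\ v) S|.
Proof.
move=> E2 vW rW rv; have vr : v != r by rewrite eq_sym.
have rWv : r \in W :\ v by rewrite !inE rv.
rewrite [#|leafy E W _|](card_trees_rooted _ E2 rW).
rewrite [#|leafy E (W :\ v) _|](card_trees_rooted _ E2 rWv) -cardsX.
set A := [set f | _ & _].
have parA f : f \in A -> exists y, f v = Some y.
  by rewrite inE => /andP[/asboolP rf _]; apply: rooted_parent rf vW vr.
pose phi f := (odflt v (f v), redirect f v None).
rewrite -(@card_in_imset _ _ phi); last first.
  move=> f g /parA[y fv] /parA[z gv]; rewrite /phi fv gv => -[yz fg].
  by rewrite -(redirectK f v None) fg fv yz -gv redirectK.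
apply/subset_leq_card/subsetP=> p /imsetP[f fA ->].
have [y fv] := parA f fA; move: fA; rewrite inE => /andP[/asboolP rf /forall_inP dS].
have dv : deg (map_edges f) v <= 1 by apply: dS; rewrite !inE eqxx.
have [_ _ edg] := rf; have [yW vyE] := edg _ _ fv.
rewrite in_setX /= fv /= in_set yW vyE in_set /=.
apply/andP; split; first by apply/asboolP; apply: rooted_del_leaf.
apply/forall_inP=> s sS; apply: (leq_trans (degS _ (redirect_None_edges f v))).
by apply: dS; rewrite !inE sS orbT.
Qed.

(** With no other leaf prescribed, [v] can be attached to any neighbour in any tree on the remaining
    vertices, so pruning becomes a bijection. *)
Lemma card_leafy1 E W r v : two_sets E -> v \in W -> r \in W -> r != v ->
  #|leafy E W [set v]| = #|nbrs E W v| * #|trees E (W :\ v)|.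
Proof.
move=> E2 vW rW rv; have vr : v != r by rewrite eq_sym.
have rWv : r \in W :\ v by rewrite !inE rv.
have := card_leafy_del set0 E2 vW rW rv; rewrite setU0 leafy0 => le.
apply/eqP; rewrite eqn_leq le /=.
rewrite -{1}leafy0 [#|leafy E (W :\ v) _|](card_trees_rooted _ E2 rWv).
rewrite [#|leafy E W _|](card_trees_rooted _ E2 rW) -cardsX.
set A := [set f | _ & _]; have rA g : g \in A -> rooted_on E (W :\ v) r g.
  by rewrite inE => /andP[/asboolP].
pose phi (p : T * {ffun T -> option T}) := redirect p.2 v (Some p.1).
rewrite -(@card_in_imset _ _ phi); last first.
  move=> [y f] [z g] /setXP[/= _ /rA rf] /setXP[/= _ /rA rg] eq_phi.
  have := congr1 (fun h : {ffun T -> option T} => h v) eq_phi.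
  rewrite /phi !redirect_same => -[yz].
  have gN h : rooted_on E (W :\ v) r h -> h v = None.
    by case=> _ dom _; apply/eqP; rewrite dom !inE eqxx andbF.
  rewrite yz; congr pair.
  rewrite -(redirectK f v (Some y)) -[in RHS](redirectK g v (Some z)) gN // gN //.
  by move: eq_phi; rewrite /phi /= => ->.
apply/subset_leq_card/subsetP=> h /imsetP[[y g] /setXP[/= yN /rA rg] ->].
rewrite inE /phi /=; apply/andP; split.
  by apply/asboolP; apply: rooted_add_leaf => //; apply: nbrs_neq yN.
by apply/forall_inP=> s; rewrite inE => /eqP->; apply: deg_add_leaf rg.
Qed.

(** With a single available neighbour, [v] is a leaf of every tree. *)
Lemma card_trees_pendant E W v w : two_sets E -> v \in W -> nbrs E W v = [set w] ->
  #|trees E W| = #|trees E (W :\ v)|.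
Proof.
move=> E2 vW nv; have wN : w \in nbrs E W v by rewrite nv inE.
have wv := nbrs_neq E2 wN; have wW : w \in W by move: wN; rewrite inE => /andP[].
have -> : trees E W = leafy E W [set v].
  apply/setP=> F; apply/idP/leafyP=> [FT|[]//]; split=> // s; rewrite inE => /eqP->.
  move: FT; rewrite inE => /and3P[/subsetP FE FW _].
  rewrite -(cards1 [set v; w]); apply/subset_leq_card/subsetP=> e.
  rewrite !inE => /andP[eF]; have [x [y [xy eE]]] := two_setsP E2 (FE e eF).
  suff vyE z : [set v; z] \in F -> [set v; z] == [set v; w].
    move: eF; rewrite eE !inE => eF /orP[] /eqP vE; rewrite -vE in eF *.
      exact: vyE.
    by rewrite setUC; apply: vyE; rewrite setUC.
  move=> vzF; have : z \in nbrs E W v.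
    by rewrite inE FE // andbT; apply: (@cover_edge _ F W z v) => //; rewrite setUC.
  by rewrite nv inE => /eqP->.
by rewrite (card_leafy1 E2 vW wW wv) nv cards1 mul1n.
Qed.

End Leaves.

(** * Degrees and leaves of a typical tree *)

Section Swaps.

Variable T : finType.
Implicit Types (E F : {set {set T}}) (W S : {set T}) (f g : {ffun T -> option T}).
Implicit Types (c x y z v r u : T).

Lemma rooted_redirect E W r f v x : rooted_on E W r f -> v \in W -> v != r ->
  x \in nbrs E W v -> ~ ancestor f x v -> rooted_on E W r (redirect f v (Some x)).
Proof.
move=> [wf dom edg] vW vr; rewrite in_set => /andP[xW vxE] anc; split.
- exact: redirect_wf.
- move=> y; rewrite redirectE; have [->|yv] := eqVneq y v; last exact: dom.
  by rewrite !inE vr vW.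
by move=> y z; rewrite redirectE; have [->[<-]//|_ /edg] := eqVneq y v.
Qed.

Lemma ancestor_linear f x y z : ancestor f x y -> ancestor f x z ->
  ancestor f y z \/ ancestor f z y.
Proof.
elim=> [{}x|{}x w {}y fx wy IH xz]; first by left.
have [xzE|] := ancestor_parent xz fx; last exact: IH.
by right; rewrite -xzE; apply: ancestor_step fx wy.
Qed.

(** The ancestors of [x] form a chain, and above a child of the root there is only the root. *)
Lemma root_child_uniq f u v w x : f u = None -> f v = Some u -> f w = Some u ->
  ancestor f x v -> ancestor f x w -> v = w.
Proof.
move=> fu fv fw xv xw.
have aux y z : f y = Some u -> f z = Some u -> ancestor f y z -> y = z.
  move=> fy fz yz; have [//|uz] := ancestor_parent yz fy.
  by case: uz fu fz => [a ->|a b c ->].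
by have [/aux->|/aux->] := ancestor_linear xv xw.
Qed.

(* Root the trees at u and let v be a child of u.  Of the D neighbours of v, those
   outside the subtree of v can replace u as the parent of v, injectively in the
   tree; the subtrees of the children of u are disjoint. *)
Lemma sum_deg_trees E W u D : two_sets E -> u \in W ->
  (forall v, v \in W -> D <= #|nbrs E W v|) ->
  D * \sum_(v in W) #|[set F in trees E W | [set v; u] \in F]|
    <= 2 * #|W| * #|trees E W|.
Proof.
move=> E2 uW minD.
pose R := [set f : {ffun T -> option T} | `[< rooted_on E W u f >]].
have cardR : #|trees E W| = #|R|.
  transitivity #|[set F in trees E W | predT F]|.
    by apply: eq_card => F; rewrite [in RHS]in_set andbT.
  rewrite (card_trees_rooted _ E2 uW); apply: eq_card => f.
  by rewrite !in_set andbT.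
have cardV v : #|[set F in trees E W | [set v; u] \in F]|
    = #|[set f in R | f v == Some u]|.
  rewrite (card_trees_rooted _ E2 uW); apply: eq_card => f.
  rewrite [LHS]in_set [RHS]in_set [f \in R]in_set mem_map_edges; case: asboolP => //= rf.
  by rewrite (rooted_root rf) orbF.
pose sub f v := [set x in W | `[< ancestor f x v >]].
(* The switch is inverted by restoring the old parent of [v], which was always [u]. *)
have swap v : v \in W ->
    \sum_(f in [set f in R | f v == Some u]) #|nbrs E W v :\: sub f v| <= #|R|.
  move=> vW; rewrite (card_sum_pairs _ (fun f => nbrs E W v :\: sub f v)).
  set A := [set p : {ffun T -> option T} * T | _].
  have AP p : p \in A -> [/\ rooted_on E W u p.1, p.1 v = Some u,
      p.2 \in nbrs E W v & ~ ancestor p.1 p.2 v].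
    rewrite in_set => /andP[/setIdP[+ /eqP fv] /setDP[pN psub]].
    rewrite in_set => /asboolP rf; split=> // anc; case/negP: psub.
    by move: pN; rewrite !in_set => /andP[-> _]; apply/asboolP.
  rewrite -(@card_in_imset _ _ (fun p => redirect p.1 v (Some p.2))); last first.
    move=> [f x] [g y] /AP[/= _ fv _ _] /AP[/= _ gv _ _] fg.
    have := congr1 (fun h : {ffun T -> option T} => h v) fg.
    rewrite /= !redirect_same => -[xy]; congr pair => //.
    by rewrite -(redirectK f v (Some x)) fg fv -gv redirectK.
  apply/subset_leq_card/subsetP=> g /imsetP[p /AP[rf fv pN anc] ->].
  rewrite in_set; apply/asboolP; apply: rooted_redirect => //.
  by case: (rooted_dom rf fv).
have disj f : f \in R -> \sum_(v in W | f v == Some u) #|sub f v| <= #|W|.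
  rewrite in_set => /asboolP rf; have fu := rooted_root rf.
  under eq_bigr => v _ do rewrite -sum1_card big_mkcond /=.
  rewrite exchange_big /= -sum1_card [X in _ <= X]big_mkcond /=.
  apply: leq_sum => x _; case: ifPn => [xW|xW]; last first.
    by rewrite big1 // => v _; rewrite in_set (negbTE xW).
  have [v /and3P[vW /eqP fv xv]|none] :=
    pickP [pred v | [&& v \in W, f v == Some u & x \in sub f v]]; last first.
    rewrite big1 // => v /andP[vW fv]; case: ifP => // xv.
    by have := none v; rewrite /= vW fv xv.
  rewrite (bigD1 v) /=; last by rewrite vW fv eqxx.
  rewrite big1 ?addn0; first by case: ifP.
  move=> w /andP[/andP[wW /eqP fw] wv]; case: ifP => // xw.
  move: xv xw; rewrite !in_set => /andP[_ /asboolP xv] /andP[_ /asboolP xw].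
  by rewrite (root_child_uniq fu fv fw xv xw) eqxx in wv.
(* One copy of [#|W| * #|R|] pays for the replacements, the other for the neighbours inside the
   subtrees. *)
rewrite big_distrr /= (_ : 2 * #|W| * _ = \sum_(v in W) #|R| + \sum_(f in R) #|W|); last first.
  by rewrite cardR !sum_nat_const; lia.
have splitV v : v \in W -> D * #|[set F in trees E W | [set v; u] \in F]|
  <= \sum_(f in [set f in R | f v == Some u]) #|nbrs E W v :\: sub f v|
     + \sum_(f in [set f in R | f v == Some u]) #|sub f v|.
  move=> vW; rewrite cardV -sum1_card big_distrr /= -big_split /=.
  apply: leq_sum => f _; rewrite muln1; apply: leq_trans (minD v vW) _.
  rewrite -(cardsID (sub f v) (nbrs E W v)) addnC leq_add2l.
  exact/subset_leq_card/subsetIr.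
apply: leq_trans; first by apply: leq_sum => v vW; apply: splitV vW.
rewrite big_split /=; apply: leq_add.
  exact: leq_sum.
rewrite (exchange_big_dep (mem R)) /=; last first.
  by move=> v f vW; rewrite in_set => /andP[].
apply: leq_sum => f fR.
apply: leq_trans (disj f fR).
rewrite leq_eqVlt; apply/orP; left; apply/eqP; apply: eq_bigl => v.
by rewrite in_set fR.
Qed.

End Swaps.

(** * A lower bound for the number of leaves *)

Section LeafCount.

Variable T : finType.
Implicit Types (E F : {set {set T}}) (W S : {set T}) (f g : {ffun T -> option T}).
Implicit Types (c x y z v r u : T).

(* The component of c after deletion of the edge cv. *)
Definition side F c v := [set x | connect (edge_rel (F :\ [set c; v])) c x].

Lemma trees_imset E W r : two_sets E -> r \in W ->
  trees E W = (@map_edges T) @: [set f | `[< rooted_on E W r f >]].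
Proof.
move=> E2 rW; apply/setP=> F; apply/idP/imsetP=> [|[f + ->]].
  case/(tree_rooted E2 rW)=> f rf <-; exists f => //.
  by rewrite in_set; apply/asboolP.
by rewrite in_set => /asboolP; apply: rooted_trees.
Qed.

Lemma ancestor_last f x c : ancestor f x c -> x != c ->
  exists2 v, f v = Some c & ancestor f x v.
Proof.
elim=> [z|{}x y {}c fx yc IH _]; first by rewrite eqxx.
have [yE|/IH[v fv yv]] := eqVneq y c.
  by exists x; [rewrite fx yE|constructor].
by exists v => //; apply: ancestor_step fx yv.
Qed.

Lemma ancestor_of_root f c v : f c = None -> ancestor f c v -> v = c.
Proof. by move=> fc cv; case: cv fc => // {}c y z ->. Qed.

(** Root the tree at [c] and let [v] be the child of [c] on the chain from [x]. Edges other than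
    [cv] do not leave the set of descendants of [v], which contains [x] but not [c]. *)
Lemma tree_branch E W F c x : two_sets E -> F \in trees E W -> c \in W -> x \in W ->
  x != c -> exists v, [/\ v \in W, [set c; v] \in F & x \notin side F c v].
Proof.
move=> E2 FT cW xW xc; have [f rf fF] := tree_rooted E2 cW FT.
have fc := rooted_root rf.
have [v fv xv] := ancestor_last (rooted_ancestor rf xW) xc.
have [vW vc] := rooted_dom rf fv.
have cvF : [set c; v] \in F by rewrite -fF setUC mem_map_edges fv eqxx.
exists v; split=> //; rewrite in_set.
pose a := [set y | `[< ancestor f y v >]].
have step y z : f y = Some z -> [set y; z] != [set c; v] -> (y \in a) = (z \in a).
  move=> fy neq; rewrite !in_set; apply/asboolP/asboolP=> [yv|]; last exact: ancestor_step.
  have [yE|//] := ancestor_parent yv fy.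
  by move: fy neq; rewrite yE fv => -[->]; rewrite setUC eqxx.
have cl : closed (edge_rel (F :\ [set c; v])) (mem a).
  move=> y z; rewrite /edge_rel in_setD1 -fF mem_map_edges => /andP[neq].
  case/orP=> /eqP h; first exact: step.
  by apply/esym/step => //; rewrite setUC.
apply/negP=> /(closed_connect cl); rewrite !in_set.
have -> : `[< ancestor f x v >] by apply/asboolP.
by move/asboolP/(ancestor_of_root fc)/eqP; rewrite (negbTE vc).
Qed.

(** With root [v], the chain from [x] up to [c] avoids the edge [cv]. Hence a vertex off the side of
    [c] is no descendant of [c] and may become its parent. *)
Lemma ancestor_side E W f c v x : rooted_on E W v f -> f c = Some v ->
  ancestor f x c -> x \in side (map_edges f) c v.
Proof.
move=> rf fc xc; have [wf _ _] := rf; have fv := rooted_root rf; rewrite in_set.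
have: c = c by []; elim: xc {-2}(c) fc => [z c' fc -> //|y z c' fy zc' IH c'' fc c'E].
rewrite c'E in fc IH zc' *.
apply: (connect_trans (IH _ fc erefl)); apply: connect1.
rewrite /edge_rel in_setD1 mem_map_edges fy eqxx orbT andbT.
apply/eqP=> /set2_inj[[zE yE]|[zE _]]; first by rewrite yE fv in fy.
by move: zc'; rewrite zE => /(ancestor_of_root fv) c''E; rewrite c''E fv in fc.
Qed.

(* If v has exactly the neighbours c and c' in F, replacing the edge cv by cx for a
   neighbour x of c on the side of v turns v into a leaf. *)
Lemma leaf_swap E W c v : two_sets E -> c \in W -> v \in W ->
  \sum_(F in trees E W | ([set c; v] \in F) && (deg F v == 2))
     #|(nbrs E W c :\: side F c v) :\ v| <= #|leafy E W [set v]|.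
Proof.
move=> E2 cW vW.
rewrite (trees_imset E2 vW) big_imset_cond /=; last first.
  move=> f g; rewrite !in_set => /asboolP rf /asboolP rg.
  exact: rooted_inj rf rg.
pose R := [set f | `[< rooted_on E W v f >] &
  ([set c; v] \in map_edges f) && (deg (map_edges f) v == 2)].
pose B f := (nbrs E W c :\: side (map_edges f) c v) :\ v.
rewrite (eq_bigl (mem R)) => [|f]; last by rewrite /= !in_set.
rewrite (card_sum_pairs R B) [X in _ <= X](card_trees_rooted _ E2 vW).
set A := [set p : {ffun T -> option T} * T | _].
have AP p : p \in A -> [/\ [/\ rooted_on E W v p.1, p.1 c = Some v & c != v],
    deg (map_edges p.1) v = 2, p.2 \in nbrs E W c, ~ ancestor p.1 p.2 c & p.2 != v].
  rewrite in_set => /andP[+ /setD1P[pv /setDP[pN ps]]].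
  rewrite in_set => /and3P[/asboolP rf]; rewrite mem_map_edges (rooted_root rf) orbF.
  move=> /eqP fc /eqP dv; split=> //; first by split=> //; case: (rooted_dom rf fc).
  by move/(ancestor_side rf fc); apply/negP.
rewrite -(@card_in_imset _ _ (fun p => redirect p.1 c (Some p.2))); last first.
  move=> [f x] [g y] /AP[/=[_ fc _] _ _ _ _] /AP[/=[_ gc _] _ _ _ _] fg.
  have := congr1 (fun h : {ffun T -> option T} => h c) fg.
  rewrite /= !redirect_same => -[xy]; congr pair => //.
  by rewrite -(redirectK f c (Some x)) fg fc -gc redirectK.
apply/subset_leq_card/subsetP=> g /imsetP[p /AP[[rf fc cv] dv pN anc pv] ->].
rewrite in_set; apply/andP; split.
  by apply/asboolP; apply: rooted_redirect.
apply/forall_inP=> s; rewrite in_set1 => /eqP->.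
have fv := rooted_root rf.
(* At the root [v] the degree counts children: there were two, and [c] is lost. Since the new parent
   of [c] is not [v], [c] does not come back. *)
rewrite deg_root; last by rewrite redirect_other // eq_sym.
rewrite deg_root // (cardsD1 c) in_set fc eqxx in dv; case: dv => <-.
apply/subset_leq_card/subsetP=> y; rewrite !in_set redirectE.
have [_|yc] := eqVneq y c; last by rewrite in_set1 yc.
by move/eqP=> -[pvE]; rewrite pvE eqxx in pv.
Qed.

Lemma leq_card_bigcup (I : finType) (P : pred I) (B : I -> {set T}) :
  #|\bigcup_(i | P i) B i| <= \sum_(i | P i) #|B i|.
Proof.
elim/big_rec2: _ => [|i n A _ le]; first by rewrite cards0.
by apply: leq_trans (leq_card_setU _ _).1 _; rewrite leq_add2l.
Qed.

Lemma card_incident F W v : \sum_(c in W | [set c; v] \in F) 1 <= deg F v.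
Proof.
rewrite sum1dep_card -(@card_in_imset _ _ (fun c => [set c; v])); last first.
  by move=> c c' _ _ /set2_inj[[]//|[-> ->]].
apply/subset_leq_card/subsetP=> e /imsetP[c]; rewrite !in_set => /andP[_ cvF] ->.
by rewrite cvF set22.
Qed.

Lemma card_tree_edges E W F r : two_sets E -> r \in W -> F \in trees E W -> #|F| <= #|W|.
Proof.
move=> E2 rW /(tree_rooted E2 rW)[f rf <-].
apply: leq_trans (leq_imset_card (fun x => [set x; odflt x (f x)]) W).
apply/subset_leq_card/subsetP=> e /map_edgesP[x [y [fx ->]]].
by apply/imsetP; exists x; [case: (rooted_dom rf fx)|rewrite fx].
Qed.

Lemma sum_deg E W F r : two_sets E -> r \in W -> F \in trees E W ->
  \sum_(v in W) deg F v <= 2 * #|W|.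
Proof.
move=> E2 rW FT; apply: (@leq_trans (2 * #|F|)); last first.
  by rewrite leq_mul2l (card_tree_edges E2 rW FT).
rewrite mulnC -sum_nat_const.
under eq_bigr => v _ do rewrite /deg -sum1dep_card big_mkcondr /=.
rewrite exchange_big /=; apply: leq_sum => e eF.
have FE : F \subset E by move: FT; rewrite in_set => /and3P[].
have <- : #|e| = 2 by apply: E2; apply: (subsetP FE).
rewrite -big_mkcondr /= sum1dep_card; apply/subset_leq_card/subsetP=> x.
by rewrite in_set => /andP[].
Qed.

(** Every degree d satisfies d [d <> 2] + 6 <= 3 d + 6 [d <= 1]. Summed over [W], the terms 3 d are
    at most [6 * #|W|] and cancel the constant 6. *)
Lemma sum_deg_neq2 E W F r : two_sets E -> r \in W -> F \in trees E W ->
  \sum_(v in W | deg F v != 2) deg F v <= 6 * #|[set v in W | deg F v <= 1]|.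
Proof.
move=> E2 rW FT; have := sum_deg E2 rW FT.
have : \sum_(v in W | deg F v != 2) deg F v + 6 * #|W|
    <= 3 * (\sum_(v in W) deg F v) + 6 * #|[set v in W | deg F v <= 1]|.
  rewrite -sum1dep_card -sum1_card big_mkcondr [in X in _ <= _ + X]big_mkcondr /=.
  rewrite !big_distrr -!big_split /=; apply: leq_sum => v _.
  by case: eqP => [->//|neq2] /=; case: (leqP (deg F v) 1) => /= le1; lia.
lia.
Qed.

(* Every neighbour of c lies on the side of v for one of the tree neighbours v of c.
   Tree neighbours of degree other than 2 are controlled by the number of leaves,
   since the degrees sum to less than 2 #|W|. *)
Lemma branch_count E W F D : two_sets E ->
  (forall v, v \in W -> D <= #|nbrs E W v|) -> F \in trees E W ->
  #|W| * D <= \sum_(c in W) \sum_(v in W | ([set c; v] \in F) && (deg F v == 2))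
                #|(nbrs E W c :\: side F c v) :\ v|
              + 2 * #|W| + 6 * #|W| * #|[set v in W | deg F v <= 1]|.
Proof.
move=> E2 minD FT; have [->|[r rW]] := set_0Vmem W; first by rewrite cards0.
have branches c : c \in W ->
    D <= \sum_(v in W | [set c; v] \in F) #|nbrs E W c :\: side F c v|.
  move=> cW; apply: leq_trans (minD c cW) _.
  apply: leq_trans (leq_card_bigcup _ _); apply/subset_leq_card/subsetP=> x xN.
  have xW : x \in W by move: xN; rewrite in_set => /andP[].
  have [v [vW cvF xs]] := tree_branch E2 FT cW xW (nbrs_neq E2 xN).
  by apply/bigcupP; exists v; rewrite ?vW // in_setD xs.
(* The 1 accounts for the removal of [v]; if [v] has degree other than 2 the crude bound [#|W|] is
   used. *)
have term c v : #|nbrs E W c :\: side F c v| <=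
    (if deg F v == 2 then #|(nbrs E W c :\: side F c v) :\ v| else 0)
    + 1 + (if deg F v == 2 then 0 else #|W|).
  case: ifP => _.
    by rewrite (cardsD1 v (_ :\: _)) addn0 addnC leq_add2l; case: (_ \in _).
  rewrite add0n addnC; apply: leq_trans (leq_addr _ _).
  apply/subset_leq_card/subsetP=> x; rewrite !in_set => /andP[_].
  by case/andP.
rewrite -sum_nat_const; apply: leq_trans; first by apply: leq_sum => c /branches; exact.
apply: leq_trans.
  apply: leq_sum => c _; apply: leq_sum => v _; exact: term.
under eq_bigr => c _ do rewrite !big_split /=.
(* The units are summed over ordered pairs adjacent in the tree, at most [2 * #|W|] of them. The
   crude terms occur, for each vertex of degree other than 2, once per tree edge at it. *)
rewrite !big_split /=; apply: leq_add; first apply: leq_add.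
- rewrite leq_eqVlt; apply/orP; left; apply/eqP; apply: eq_bigr => c _.
  by rewrite -big_mkcondr; apply: eq_bigl => v; rewrite andbA.
- rewrite (exchange_big_dep (mem W)) /=; last by move=> ? ? _ /andP[].
  apply: leq_trans (sum_deg E2 rW FT); apply: leq_sum => v vW.
  by apply: leq_trans (card_incident F W v); rewrite vW.
rewrite (exchange_big_dep (mem W)) /=; last by move=> ? ? _ /andP[].
rewrite [6 * _]mulnC -mulnA; apply: (@leq_trans (#|W| * \sum_(v in W | deg F v != 2) deg F v)).
  rewrite big_distrr /= [X in _ <= X]big_mkcondr /=; apply: leq_sum => v vW.
  case: eqP => _; first by rewrite big1.
  rewrite vW sum_nat_cond_const mulnC leq_mul2l; apply/orP; right.
  by rewrite -sum1dep_card; apply: card_incident.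
by rewrite leq_mul2l (sum_deg_neq2 E2 rW FT) orbT.
Qed.

(** Sum [branch_count] over all trees. By [leaf_swap], for each [c] the switches number at most the
    pairs of a tree and a leaf; cancelling [#|W|] leaves the factor 7 = 1 + 6. *)
Lemma leafy_lower E W D : two_sets E -> W != set0 ->
  (forall v, v \in W -> D <= #|nbrs E W v|) ->
  D * #|trees E W| <= 7 * \sum_(v in W) #|leafy E W [set v]| + 2 * #|trees E W|.
Proof.
move=> E2 /set0Pn[r rW] minD.
have W0 : 0 < #|W| by apply/card_gt0P; exists r.
have leafE : \sum_(F in trees E W) #|[set v in W | deg F v <= 1]|
    = \sum_(v in W) #|leafy E W [set v]|.
  under eq_bigr => F _ do rewrite -sum1dep_card big_mkcondr /=.
  rewrite exchange_big /=; apply: eq_bigr => v _.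
  rewrite -big_mkcondr /= sum1dep_card; apply: eq_card => F.
  apply/setIdP/leafyP=> [[FT dv]|[FT dv]]; split=> //; last by apply: dv; rewrite in_set1.
  by move=> s; rewrite in_set1 => /eqP->.
have main : \sum_(F in trees E W) #|W| * D <=
    #|W| * \sum_(v in W) #|leafy E W [set v]| + 2 * #|W| * #|trees E W|
    + 6 * #|W| * \sum_(v in W) #|leafy E W [set v]|.
  apply: leq_trans; first by apply: leq_sum => F /(branch_count E2 minD); exact.
  rewrite big_split /= big_split /= sum_nat_const -big_distrr /= leafE [#|trees _ _| * _]mulnC.
  rewrite leq_add2r leq_add2r exchange_big /= -sum_nat_const; apply: leq_sum => c cW.
  rewrite (exchange_big_dep (mem W)) /=; last by move=> ? ? _ /andP[].
  apply: leq_sum => v vW; apply: leq_trans (leaf_swap E2 cW vW).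
  rewrite leq_eqVlt; apply/orP; left; apply/eqP; apply: eq_bigl => F.
  by rewrite vW.
move: main; rewrite sum_nat_const; nia.
Qed.

End LeafCount.

(** * The matrix-tree theorem and log-submodularity *)

Section RankOneUpdates.

Local Open Scope ring_scope.

Variables (K : realFieldType) (n : nat).
Implicit Types (M : 'M[K]_n) (c x : 'cV[K]_n).

Definition quad M x : K := (x^T *m M *m x) 0 0.

Lemma quadD M M' x : quad (M + M') x = quad M x + quad M' x.
Proof. by rewrite /quad mulmxDr mulmxDl mxE. Qed.

Lemma quad_rank1_ge0 c x : 0 <= quad (c *m c^T) x.
Proof.
rewrite /quad mulmxA -mulmxA.
have -> : c^T *m x = (x^T *m c)^T by rewrite trmx_mul trmxK.
rewrite mxE big_ord1 [in X in _ * X]mxE -expr2; exact: sqr_ge0.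
Qed.

(** Both sides are the determinant of [N], made block triangular by multiplying with the unipotent
    [P] on the right or on the left. *)
Lemma det_add1_rank1 c (b : 'rV[K]_n) : \det (1%:M + c *m b) = 1 + (b *m c) 0 0.
Proof.
pose P := block_mx (1%:M : 'M[K]_1) b 0 (1%:M : 'M_n).
pose Q := block_mx (1%:M : 'M[K]_1) 0 c (1%:M : 'M_n).
pose N := block_mx (1%:M : 'M[K]_1) (- b) c (1%:M : 'M_n).
have PN : N *m P = block_mx 1%:M 0 c (1%:M + c *m b).
  rewrite mulmx_block !mul1mx !mulmx1 !mulmx0 !addr0 subrr.
  by congr block_mx; rewrite addrC.
have NQ : P *m N = block_mx (1%:M + b *m c) 0 c 1%:M.
  by rewrite mulmx_block !mul1mx !mulmx1 !mul0mx !add0r addNr.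
have detP : \det P = 1 by rewrite det_ublock !det1 mulr1.
have := congr1 determinant PN; rewrite det_mulmx detP mulr1 det_lblock det1 mul1r => <-.
have := congr1 determinant NQ; rewrite det_mulmx detP mul1r det_lblock det1 mulr1 => ->.
by rewrite det_mx11 !mxE eqxx.
Qed.

Lemma det_rank1 M c : M \in unitmx ->
  \det (M + c *m c^T) = \det M * (1 + quad (invmx M) c).
Proof.
move=> Mu; have -> : M + c *m c^T = M *m (1%:M + invmx M *m c *m c^T).
  by rewrite mulmxDr mulmx1 !mulmxA mulmxV // mul1mx.
by rewrite det_mulmx det_add1_rank1 /quad mulmxA.
Qed.

(* c^T M^-1 c is the maximum over y of 2 y^T c - y^T M y. *)
Lemma quad_inv_anti M M' c : M^T = M -> M'^T = M' -> M \in unitmx -> M' \in unitmx ->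
  (forall x, 0 <= quad M x) -> (forall x, quad M x <= quad M' x) ->
  quad (invmx M') c <= quad (invmx M) c.
Proof.
move=> Ms M's Mu M'u Mpos MM'.
pose y := invmx M' *m c; pose z := invmx M *m c.
pose s (u v : 'cV[K]_n) := (u^T *m v) 0 0.
have sC u v : s u v = s v u.
  by rewrite /s -[u^T *m v]trmxK [in LHS]mxE trmx_mul trmxK.
have yE : quad (invmx M') c = quad M' y.
  by rewrite /quad /y trmx_mul trmx_inv M's !mulmxA mulmxKV.
have ycE : quad (invmx M') c = s y c.
  by rewrite sC /s /quad /y mulmxA.
have zcE : quad (invmx M) c = s z c.
  by rewrite sC /s /quad /z mulmxA.
have Mz : M *m z = c by rewrite /z mulmxA mulmxV // mul1mx.
(* Since [quad M y <= quad M' y] and the latter equals y^T c, nonnegativity at [y - z] leaves y^T c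
   <= z^T c. *)
have := Mpos (y - z); have -> : quad M (y - z) = quad M y - 2 * s y c + s z c.
  have trB : (y - z)^T = y^T - z^T by apply/matrixP=> i j; rewrite !mxE.
  have szMy : s z (M *m y) = s y c.
    by rewrite /s mulmxA -{1}Ms -trmx_mul Mz -/(s c y) sC.
  rewrite /quad trB !mulmxBl !mulmxBr -!mulmxA Mz.
  have e (u v : 'M[K]_1) : (u - v) 0 0 = u 0 0 - v 0 0 by rewrite !mxE.
  rewrite !e -/(s y c) -/(s z c) -/(s z (M *m y)) szMy; lra.
have := MM' y; rewrite -yE -zcE ycE; lra.
Qed.

Lemma det_rank1_submod M M' c : M^T = M -> M'^T = M' -> 0 < \det M -> 0 < \det M' ->
  (forall x, 0 <= quad M x) -> (forall x, quad M x <= quad M' x) ->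
  \det (M' + c *m c^T) * \det M <= \det M' * \det (M + c *m c^T).
Proof.
move=> Ms M's dM dM' Mpos MM'.
have Mu : M \in unitmx by rewrite unitmxE unitfE gt_eqF.
have M'u : M' \in unitmx by rewrite unitmxE unitfE gt_eqF.
rewrite !det_rank1 // mulrAC -!mulrA !ler_pM2l // lerD2l.
exact: quad_inv_anti.
Qed.

End RankOneUpdates.

(** * The matrix-tree theorem *)

Section MatrixTree.

Local Open Scope ring_scope.

Variables (K : realFieldType) (T : finType).
Implicit Types (E A : {set {set T}}) (W Z : {set T}) (f : {ffun T -> option T}).

Local Notation n := #|T|.
Local Notation ev := (@enum_val T T).

(** Multilinearity in the rows: the expansion chooses one summand [f i] in each row [i]. *)
Lemma det_sum_rows (m : nat) (J : finType) (w : 'I_m -> J -> K)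
    (v : 'I_m -> J -> 'I_m -> K) :
  \det (\matrix_(i, j) \sum_o w i o * v i o j) =
  \sum_(f : {ffun 'I_m -> J}) (\prod_i w i (f i)) * \det (\matrix_(i, j) v i (f i) j).
Proof.
rewrite /determinant.
under eq_bigr => s _.
  under eq_bigr => i _ do rewrite mxE.
  rewrite (bigA_distr_bigA (fun i o => w i o * v i o (s i))) /= big_distrr /=.
  over.
rewrite exchange_big /=; apply: eq_bigr => f _.
rewrite big_distrr /=; apply: eq_bigr => s _.
rewrite big_split /= mulrCA; congr (_ * (_ * _)).
by apply: eq_bigr => i _; rewrite mxE.
Qed.

Definition parent_mx f : 'M[K]_n :=
  \matrix_(i, j) ((ev j == ev i)%:R - (f (ev i) == Some (ev j))%:R).

(* If f is acyclic, only the identity contributes to the determinant; otherwise the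
   indicator of the points that never reach None is in the kernel. *)
Lemma det_parent_mx f : \det (parent_mx f) = `[< well_founded (parent_of f) >]%:R.
Proof.
case: asboolP => [wf|nwf] /=.
  have f_irr x : f x != Some x.
    apply/eqP=> fx; apply: (parent_not_ancestor wf fx); constructor.
  rewrite /determinant (bigD1 (1%g : {perm _})) //= odd_perm1 expr0 mul1r.
  rewrite [X in X + _]big1; last first.
    by move=> i _; rewrite mxE perm1 eqxx (negbTE (f_irr _)) subr0.
  rewrite big1 ?addr0 // => s s1; apply/eqP; rewrite mulf_eq0; apply/orP; right.
  apply: contraNT s1 => /prodf_neq0 nz; apply/eqP/permP=> i; rewrite perm1.
  apply/eqP; apply/negPn/negP=> si.
  (* A nonzero product forces [s] to send a moved index to its parent, which is then moved as well;
     such a chain never ends. *)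
  have [x xE] : exists x, x = ev i by exists (ev i).
  elim: {x}(wf x) i si xE => x _ IH i si xE.
  have /eqP := nz i isT; rewrite mxE (inj_eq enum_val_inj) (negbTE si) sub0r.
  case: eqP => [fi _|_]; last by rewrite oppr0.
  apply: (IH (ev (s i)) _ (s i)) => //; first by rewrite /parent_of xE.
  by rewrite (inj_eq perm_inj).
apply/eqP; rewrite -det_tr; apply/det0P.
pose C x := `[< ~ Acc (parent_of f) x >].
have CE x : C x = if f x is Some y then C y else false.
  rewrite /C; apply/asboolP/idP=> [nx|].
    case fx: (f x) => [y|]; last by case: nx; constructor=> y; rewrite /parent_of fx.
    apply/asboolP=> acc_y; case: nx; constructor=> z; rewrite /parent_of fx.
    by case=> <-.
  by case fx: (f x) => [y|//] /asboolP ny accx; case: ny; case: accx => /(_ y fx).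
exists (\row_i (C (ev i))%:R).
  have [x nx] : exists x, ~ Acc (parent_of f) x by apply/existsNP.
  apply/eqP=> /rowP /(_ (enum_rank x)); rewrite !mxE enum_rankK.
  have -> : C x = true by apply/asboolP.
  by apply/eqP; rewrite oner_eq0.
apply/rowP=> i; rewrite !mxE.
under eq_bigr => j _ do rewrite !mxE mulrBr.
rewrite sumrB (bigD1 i) //= eqxx mulr1 big1 ?addr0; last first.
  by move=> j ji; rewrite (inj_eq enum_val_inj) (negbTE ji) mulr0.
rewrite CE; case fi: (f (ev i)) => [y|]; last first.
  by rewrite big1 ?subr0 // => j _; rewrite mulr0.
rewrite (bigD1 (enum_rank y)) //= enum_rankK eqxx mulr1 big1 ?addr0 ?subrr //.
move=> j jy; case: eqP => [[yE]|]; last by rewrite mulr0.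
by rewrite yE enum_valK eqxx in jy.
Qed.

Lemma sum_option (J : finType) (F : option J -> K) :
  \sum_o F o = F None + \sum_j F (Some j).
Proof.
rewrite (bigD1 None) //=; congr (_ + _).
rewrite (reindex_omap Some id) /=; last by case.
by apply: eq_bigl => j; rewrite eqxx.
Qed.

(* Choosing Z as the complement of W minus a root r amounts to deleting from the
   Laplacian the rows and columns of r and of the points outside W. *)
Definition lap E Z : 'M[K]_n := \matrix_(i, j)
  ((ev j == ev i)%:R * ((ev i \in Z)%:R + #|nbrs E setT (ev i)|%:R)
   - ([set ev i; ev j] \in E)%:R).

(** The row of [x] is the sum, over the admissible values of a parent map at [x], of the
    corresponding rows of [parent_mx]. Expanding over all maps, each admissible acyclic one
    contributes 1 and all others 0. *)
Lemma det_lap E Z : \det (lap E Z) =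
  #|[set f | `[< well_founded (parent_of f) >] &
     [forall x, if f x is Some y then [set x; y] \in E else x \in Z]]|%:R.
Proof.
pose w x o : K := (if o is Some y then [set x; y] \in E else x \in Z)%:R.
have -> : lap E Z = \matrix_(i, j) \sum_(o : option T)
    w (ev i) o * ((ev j == ev i)%:R - (o == Some (ev j))%:R).
  apply/matrixP=> i j; rewrite !mxE sum_option /= subr0.
  under [in RHS]eq_bigr => y _ do rewrite mulrBr.
  rewrite sumrB mulrDr mulrC -addrA; congr (_ + _); congr (_ - _).
    rewrite -big_distrl /= [RHS]mulrC; congr (_ * _).
    by rewrite -sum1_card natr_sum big_mkcond /=; apply: eq_bigr => y _;
       rewrite /w in_set in_setT /=; case: (_ \in E).
  rewrite (bigD1 (ev j)) //= eqxx mulr1 big1 ?addr0 // => y yj.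
  by rewrite (inj_eq Some_inj) (negbTE yj) mulr0.
rewrite (det_sum_rows (fun i => w (ev i))
  (fun i o j => (ev j == ev i)%:R - (o == Some (ev j))%:R)).
pose tr (f : {ffun T -> option T}) : {ffun 'I_n -> option T} := [ffun i => f (ev i)].
rewrite (reindex tr) /=; last first.
  exists (fun g : {ffun 'I_n -> option T} => [ffun x => g (enum_rank x)]) => g _.
    by apply/ffunP=> x; rewrite !ffunE enum_rankK.
  by apply/ffunP=> i; rewrite !ffunE enum_valK.
set A := [set f | _ & _]; rewrite -[#|A|]sum1_card natr_sum [RHS]big_mkcond /=.
apply: eq_bigr => f _.
have -> : (\matrix_(i, j) ((ev j == ev i)%:R - (tr f i == Some (ev j))%:R)) = parent_mx f.
  by apply/matrixP=> i j; rewrite !mxE ffunE.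
rewrite det_parent_mx /A in_set; case: (`[< _ >]); last by rewrite mulr0.
rewrite mulr1 /=; case: forallP => [all|nall].
  by apply: big1 => i _; rewrite ffunE /w; have := all (ev i); case: (f (ev i)) => [y|] ->.
move/existsNP: nall => [x nx].
rewrite (bigD1 (enum_rank x)) //= ffunE enum_rankK /w.
by move: nx; case: (f x) => [y|] /negP/negbTE ->; rewrite mul0r.
Qed.

End MatrixTree.

(** * Laplacians under addition of edges *)

Section Rayleigh.

Local Open Scope ring_scope.

Variables (K : realFieldType) (T : finType).
Implicit Types (E A : {set {set T}}) (W Z e : {set T}) (f : {ffun T -> option T}).

Local Notation n := #|T|.
Local Notation ev := (@enum_val T T).

Lemma set2_eqE (x y a b : T) : ([set x; y] == [set a; b] :> {set T}) =
  (x == a) && (y == b) || (x == b) && (y == a).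
Proof.
apply/eqP/orP=> [/set2_inj[[-> ->]|[-> ->]]|[]/andP[/eqP-> /eqP->]].
- by left; rewrite !eqxx.
- by right; rewrite !eqxx.
- by [].
exact: setUC.
Qed.

(** The vector [c] is the difference of the indicators of the two ends of [e]. It is chosen before
    [E] and [Z], so that one vector serves two edge sets. *)
Lemma lap_setU1 e : #|e| = 2 -> exists c : 'cV[K]_n, forall E Z, e \notin E ->
  lap K (e |: E) Z = lap K E Z + c *m c^T.
Proof.
move=> /eqP/cards2P [a [b [ab eab]]].
pose d (x y : T) : K := (x == y)%:R.
pose h (x y : T) : K := ([set x; y] == e)%:R.
have hE x y : h x y = d x a * d y b + d x b * d y a.
  rewrite /h /d eab set2_eqE.
  have [->|xa] := eqVneq x a; have [->|ya] := eqVneq y a; rewrite ?eqxx ?(negbTE ab) /=;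
    rewrite ?(negbTE xa) ?(negbTE ya) /= ?andbT ?andbF ?orbF;
    rewrite ?mul0r ?mulr0 ?mul1r ?mulr1 ?addr0 ?add0r //.
have nbrsE (E' : {set {set T}}) x :
    #|nbrs E' setT x|%:R = \sum_y ([set x; y] \in E')%:R :> K.
  rewrite -sum1_card natr_sum big_mkcond /=; apply: eq_bigr => y _.
  by rewrite in_set in_setT /=; case: (_ \in E').
have sum_d (x : T) : \sum_y d y x = 1.
  by rewrite /d (bigD1 x) //= eqxx big1 ?addr0 // => y /negbTE ->.
exists (\col_i (d (ev i) a - d (ev i) b)) => E Z eE; apply/matrixP=> i j.
have inE' x y : ([set x; y] \in e |: E)%:R = h x y + ([set x; y] \in E)%:R :> K.
  rewrite in_setU1 /h; have [->|_] := eqVneq [set x; y] e; last by rewrite add0r.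
  by rewrite (negbTE eE) addr0.
rewrite !mxE big_ord1 !mxE !nbrsE.
under eq_bigr => y _ do rewrite inE' hE.
rewrite !big_split -!big_distrr /= !sum_d inE' hE.
set x := ev i; set y := ev j; rewrite -/(d y x).
suff : d y x * (d x a + d x b) - (d x a * d y b + d x b * d y a)
    = (d x a - d x b) * (d y a - d y b) by lra.
have dd (z : T) : d y x * d x z = d x z * d y z.
  rewrite /d; have [->|xz] := eqVneq x z; first by rewrite mulrC.
  by rewrite mulr0 mul0r.
by rewrite mulrDr !dd; ring.
Qed.

Lemma lap_sym E Z : (lap K E Z)^T = lap K E Z.
Proof.
apply/matrixP=> i j; rewrite !mxE setUC; congr (_ - _).
by rewrite eq_sym; case: eqP => [->//|_]; rewrite !mul0r.
Qed.

Lemma quad_lap0 Z x : 0 <= quad (lap K set0 Z) x.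
Proof.
have -> : lap K set0 Z = diag_mx (\row_i (ev i \in Z)%:R).
  apply/matrixP=> i j; rewrite !mxE in_set0 subr0.
  have -> : nbrs set0 setT (ev i) = set0 by apply/setP=> y; rewrite !inE.
  by rewrite cards0 addr0 (inj_eq enum_val_inj) eq_sym mulrC mulr_natr.
rewrite /quad mxE; apply: sumr_ge0 => i _.
rewrite mul_mx_diag !mxE mulrAC -expr2 mulr_ge0 ?sqr_ge0 //.
Qed.

(** Each added edge contributes a positive semidefinite matrix of rank one. *)
Lemma quad_lap_mono A E Z x : two_sets (A :|: E) -> [disjoint A & E] ->
  quad (lap K E Z) x <= quad (lap K (A :|: E) Z) x.
Proof.
move En : #|A| => m; elim: m A En => [|m IH] A cA AE2 dis.
  by move/eqP: cA; rewrite cards_eq0 => /eqP->; rewrite set0U.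
have [e eA] : exists e, e \in A by apply/card_gt0P; rewrite cA.
have AeE : A :|: E = e |: ((A :\ e) :|: E) by rewrite setUA setD1K.
have [c lapE] : exists c : 'cV[K]_n,
    lap K (A :|: E) Z = lap K ((A :\ e) :|: E) Z + c *m c^T.
  have [|c lapE] := @lap_setU1 e; first by apply: AE2; rewrite in_setU eA.
  by exists c; rewrite AeE; apply: lapE; rewrite !inE eqxx /= (disjointFr dis).
rewrite lapE quadD ler_wpDr ?quad_rank1_ge0 // IH //.
- by move: cA; rewrite (cardsD1 e) eA => -[].
- by apply: two_setsS AE2; rewrite setSU // subD1set.
by apply: disjointWl dis; apply: subD1set.
Qed.

Lemma quad_lap_ge0 E Z x : two_sets E -> 0 <= quad (lap K E Z) x.
Proof.
move=> E2; apply: le_trans (quad_lap0 Z x) _.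
by rewrite -[E]setU0; apply: quad_lap_mono; rewrite ?setU0 // disjoints_subset setC0 subsetT.
Qed.

(** Points outside [W] have no edges and hence no parent. The maps counted by [det_lap] could give
    [r] a parent, but a chain inside [W] can only stop at [r], so this would close a cycle. *)
Lemma det_lap_trees E W r : two_sets E -> r \in W -> (forall e, e \in E -> e \subset W) ->
  \det (lap K E (~: (W :\ r))) = #|trees E W|%:R.
Proof.
move=> E2 rW EW; rewrite det_lap (trees_imset E2 rW) card_in_imset; last first.
  by move=> f g; rewrite !in_set => /asboolP rf /asboolP rg; apply: rooted_inj rf rg.
congr (_%:R); apply: eq_card => f; rewrite [LHS]in_set [RHS]in_set.
have inW x y : [set x; y] \in E -> x \in W /\ y \in W.
  by move=> /EW /subsetP sW; rewrite !sW ?set21 ?set22.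
apply/andP/asboolP=> [[/asboolP wf /forallP fP]|[wf dom edg]]; last first.
  split; first exact/asboolP.
  apply/forallP=> x; case fx: (f x) => [y|]; first by case: (edg _ _ fx).
  by rewrite in_setC -dom fx.
have fE x y : f x = Some y -> [set x; y] \in E by move=> fx; have := fP x; rewrite fx.
have dom x : x \in W :\ r -> f x != None.
  by move=> xW; have := fP x; case: (f x) => //; rewrite in_setC xW.
have anc x : x \in W -> ancestor f x r.
  elim: {x}(wf x) => x _ IH xW; have [->|xr] := eqVneq x r; first by constructor.
  have := dom x; rewrite !inE xr xW => /(_ isT); case fx: (f x) => [y|//] _.
  by apply: (ancestor_step fx); apply: (IH y fx); case: (inW _ _ (fE _ _ fx)).
split=> //; last by move=> x y /fE xyE; split=> //; case: (inW _ _ xyE).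
move=> x; case: (boolP (x \in W :\ r)) => [/dom/negbTE//|xW].
case fx: (f x) => [y|//]; have [xW' yW] := inW _ _ (fE _ _ fx).
move: xW; rewrite !inE xW' andbT negbK => /eqP xr.
by case: (parent_not_ancestor wf fx); rewrite xr; apply: anc.
Qed.

End Rayleigh.

(** * Log-submodularity of tree counts *)

Section RayleighTrees.

Variable T : finType.
Implicit Types (E A : {set {set T}}) (W e : {set T}).

Lemma card_treesS E E' W : E \subset E' -> #|trees E W| <= #|trees E' W|.
Proof.
move=> EE'; apply/subset_leq_card/subsetP=> F; rewrite !in_set => /and3P[FE -> ->].
by rewrite (subset_trans FE EE').
Qed.

(** Adding [e] is the same rank-one update of both Laplacians, and that of [E'] dominates that of
    [E], so [det_rank1_submod] applies. *)
Lemma trees_rayleigh1 E E' W e : two_sets (e |: E') -> E \subset E' -> e \notin E' ->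
  #|trees (e |: E') W| * #|trees E W| <= #|trees E' W| * #|trees (e |: E) W|.
Proof.
move=> E2 EE' eE'.
have [->|[r rW]] := set_0Vmem W.
  suff -> : trees E set0 = set0 by rewrite cards0 muln0.
  apply/setP=> F; rewrite [RHS]in_set0; apply/negP.
  by rewrite in_set => /and3P[_ _ /asboolP[[]]]; rewrite cards0.
(* The matrix-tree theorem is stated for edges inside [W], and the other edges do not affect the
   trees on [W]. *)
pose res A := [set e in A | e \subset W].
have resE A : trees A W = trees (res A) W.
  by apply: trees_ext => a aW; rewrite in_set aW andbT.
have [eW|eW] := boolP (e \subset W); last first.
  have eT A : trees (e |: A) W = trees A W.
    apply: trees_ext => a aW; rewrite in_setU1; case: eqP => // ae.
    by rewrite -ae aW in eW.
  by rewrite !eT mulnC.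
have resU A : res (e |: A) = e |: res A.
  apply/setP=> a; rewrite in_set !in_setU1 in_set.
  by have [->|_] := eqVneq a e; rewrite ?eW.
rewrite !(resE (_ |: _)) (resE E) (resE E') !resU.
have {}E2 : two_sets (e |: res E').
  apply: two_setsS E2; by apply/setUS/subsetP=> a; rewrite in_set => /andP[->].
have {}EE' : res E \subset res E'.
  by apply/subsetP=> a; rewrite !in_set => /andP[/(subsetP EE') ->].
have {}eE' : e \notin res E' by rewrite in_set (negbTE eE').
have resW A a : a \in res A -> a \subset W by rewrite in_set => /andP[].
have eResW A a : a \in e |: res A -> a \subset W.
  by rewrite in_setU1 => /orP[/eqP->|/resW].
move: (res E) (res E') (resW E) (resW E') (eResW E) (eResW E') EE' eE' E2.
move=> {resU resW eResW resE} {}E {}E' EW EW' eEW eEW' EE' eE' eE2.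
have eE : e \notin E by apply: contra eE'; apply: (subsetP EE').
have E'2 : two_sets E' by apply: two_setsS eE2; apply: subsetUr.
have eE'' : e |: E \subset e |: E' by rewrite setUS.
have E2 := two_setsS EE' E'2; have eE2' := two_setsS eE'' eE2.
(* If there is no tree the left side vanishes; otherwise both determinants are positive. *)
have [->|tE] := posnP #|trees E W|; first by rewrite muln0.
have tE' : 0 < #|trees E' W| by apply: leq_trans tE (card_treesS W EE').
pose Z := ~: (W :\ r).
have dE := det_lap_trees rat E2 rW EW; have dE' := det_lap_trees rat E'2 rW EW'.
have deE := det_lap_trees rat eE2' rW eEW; have deE' := det_lap_trees rat eE2 rW eEW'.
have [|c cE] := @lap_setU1 rat _ e; first by apply: eE2; rewrite setU11.
have E'D : E' = (E' :\: E) :|: E by rewrite -{1}(setID E' E) setUC (setIidPr EE').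
have := @det_rank1_submod rat _ (lap _ E Z) (lap _ E' Z) c (lap_sym _ _ _) (lap_sym _ _ _).
rewrite -!cE // /Z deE deE' dE dE' -!natrM ler_nat !ltr0n; apply=> // x.
  exact: quad_lap_ge0.
rewrite E'D; apply: quad_lap_mono; first by rewrite -E'D.
by rewrite disjoints_subset setDE subsetIr.
Qed.

(** The edges of [A] are added one at a time and the resulting inequalities are multiplied. *)
Lemma trees_rayleigh A E E' W : two_sets (A :|: E') -> E \subset E' ->
  [disjoint A & E'] ->
  #|trees (A :|: E') W| * #|trees E W| <= #|trees E' W| * #|trees (A :|: E) W|.
Proof.
move En : #|A| => m; elim: m A En => [|m IH] A cA AE2 EE' dis.
  by move/eqP: cA; rewrite cards_eq0 => /eqP->; rewrite !set0U.
have [e eA] : exists e, e \in A by apply/card_gt0P; rewrite cA.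
have Ae (B : {set {set T}}) : A :|: B = e |: ((A :\ e) :|: B) by rewrite setUA setD1K.
have [->|tE] := posnP #|trees E W|; first by rewrite muln0.
have {}IH := IH (A :\ e).
(* This intermediate count links the inequality for [e] to the one for the other edges. *)
rewrite -(@leq_pmul2r #|trees ((A :\ e) :|: E) W|); last first.
  by apply: leq_trans tE (card_treesS W _); apply: subsetUr.
have step : #|trees (A :|: E') W| * #|trees (A :\ e :|: E) W| <=
    #|trees (A :\ e :|: E') W| * #|trees (A :|: E) W|.
  rewrite !Ae; apply: trees_rayleigh1; first by rewrite -Ae.
    by rewrite setUS.
  by rewrite !inE eqxx /= (disjointFr dis).
have ih : #|trees (A :\ e :|: E') W| * #|trees E W| <=
    #|trees E' W| * #|trees (A :\ e :|: E) W|.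
  apply: IH => //; first by move: cA; rewrite (cardsD1 e) eA => -[].
    by apply: two_setsS AE2; rewrite setSU // subD1set.
  by apply: disjointWl dis; apply: subD1set.
move: step ih; nia.
Qed.

End RayleighTrees.

(** * Deleting vertices *)

Section VertexDeletion.

Variable T : finType.
Implicit Types (E A : {set {set T}}) (W S e : {set T}) (u v w : T).

(* Removing these edges makes u pendant at w. *)
Definition pruned E u w := [set e in E | (u \in e) && (e != [set u; w])].

Lemma trees_setD E A W : (forall e : {set T}, e \in A -> e \subset W -> false) ->
  trees (E :\: A) W = trees E W.
Proof.
move=> AW; apply: trees_ext => e eW; rewrite in_setD.
by case: (boolP (e \in A)) => // /AW /(_ eW).
Qed.

Lemma pruned_sub E u w W e : e \in pruned E u w -> e \subset W -> u \in W.
Proof. by rewrite in_set => /and3P[_ ue _] /subsetP; apply. Qed.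

Lemma nbrs_pruned E A W u w : w \in nbrs E W u -> pruned E u w \subset A ->
  [set u; w] \notin A -> nbrs (E :\: A) W u = [set w].
Proof.
rewrite in_set => /andP[wW uwE] /subsetP pA uwA; apply/setP=> y.
rewrite in_set in_setD in_set1; apply/and3P/eqP=> [[_ yA yE]|->//].
apply/eqP; apply: contraNT yA => yw; apply: pA.
rewrite in_set yE set21 /=; apply: contra yw => /eqP /set2_inj[[_ ->//]|[-> ->//]].
Qed.

(* Trees on W - u are trees on W once u is pendant, so that all four counts are on
   the same vertex set. *)
Lemma trees_vertex_rayleigh E W u v w x : two_sets E -> u \in W -> v \in W ->
  u != v -> [set u; v] \notin E -> w \in nbrs E W u -> x \in nbrs E W v ->
  #|trees E (W :\ u :\ v)| * #|trees E W| <= #|trees E (W :\ u)| * #|trees E (W :\ v)|.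
Proof.
move=> E2 uW vW uv uvE wN xN.
have wE : [set u; w] \in E by move: wN; rewrite in_set => /andP[].
have xE : [set v; x] \in E by move: xN; rewrite in_set => /andP[].
have wv : w != v by apply: contraNneq uvE => <-.
have xu : x != u by apply: contraNneq uvE => <-; rewrite setUC.
have wu := nbrs_neq E2 wN; have xv := nbrs_neq E2 xN.
pose A := pruned E u w; pose B := pruned E v x; pose E0 := E :\: (A :|: B).
have AE : A \subset E by apply/subsetP=> e; rewrite in_set => /and3P[].
have BE : B \subset E by apply/subsetP=> e; rewrite in_set => /and3P[].
(* No edge contains both [u] and [v], so the two prunings remove disjoint sets. *)
have AB e : e \in A -> e \in B -> false.
  rewrite !in_set => /and3P[eE ue _] /and3P[_ ve _].
  have [a [b [ab eE']]] := two_setsP E2 eE; rewrite eE' !inE in ue ve eE.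
  case/negP: uvE; move: uv eE.
  by case/orP: ue => /eqP->; case/orP: ve => /eqP->; rewrite ?eqxx // setUC.
have uwB : [set u; w] \notin A :|: B.
  by rewrite in_setU !in_set eqxx !andbF /= !inE eq_sym (negbTE uv) eq_sym (negbTE wv) !andbF.
have vxA : [set v; x] \notin A :|: B.
  by rewrite in_setU !in_set eqxx !andbF orbF !inE (negbTE uv) eq_sym (negbTE xu) !andbF.
have BE0 : B :|: E0 = E :\: A.
  apply/setP=> e; rewrite in_setU !in_setD in_setU negb_or.
  case: (boolP (e \in B)) => eB /=; last by rewrite andbT.
  by rewrite (subsetP BE e eB) andbT; apply/esym/negP=> /AB/(_ eB).
have AE0 : A :|: E0 = E :\: B.
  apply/setP=> e; rewrite in_setU !in_setD in_setU negb_or.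
  case: (boolP (e \in A)) => eA //=.
  by rewrite (subsetP AE e eA) andbT; apply/esym/negP=> /(AB _ eA).
have AU : A :|: (B :|: E0) = E.
  by rewrite BE0 -{1}(setIidPr AE) setID.
(* [E0] is pruned at both vertices, [E :\: A] at [u], [E :\: B] at [v], and [E] at neither. *)
have := @trees_rayleigh T A E0 (B :|: E0) W.
rewrite AU AE0 BE0 => /(_ E2) ray.
have ED (C : {set {set T}}) : two_sets (E :\: C) by apply: two_setsS E2; apply: subsetDl.
have uA : nbrs (E :\: A) W u = [set w].
  apply: nbrs_pruned => //; apply: contra uwB; rewrite in_setU => -> //.
have vB : nbrs (E :\: B) W v = [set x].
  apply: nbrs_pruned => //; apply: contra vxA; rewrite in_setU => ->; exact: orbT.
have uE0 : nbrs E0 W u = [set w] by apply: nbrs_pruned => //; apply: subsetUl.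
have vE0 : nbrs E0 (W :\ u) v = [set x].
  apply: nbrs_pruned => //; last exact: subsetUr.
  by move: xN; rewrite in_set => /andP[xW _]; rewrite in_set in_setD1 xu xW.
have tA : #|trees (E :\: A) W| = #|trees E (W :\ u)|.
  rewrite (card_trees_pendant (ED A) uW uA) trees_setD // => e eA.
  by move/(pruned_sub eA); rewrite !inE eqxx.
have tB : #|trees (E :\: B) W| = #|trees E (W :\ v)|.
  rewrite (card_trees_pendant (ED B) vW vB) trees_setD // => e eB.
  by move/(pruned_sub eB); rewrite !inE eqxx.
have tE0 : #|trees E0 W| = #|trees E (W :\ u :\ v)|.
  rewrite (card_trees_pendant (ED _) uW uE0).
  rewrite (card_trees_pendant (ED _) _ vE0); last by rewrite !inE eq_sym uv.
  rewrite trees_setD // => e; rewrite in_setU => /orP[] /pruned_sub h /h.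
    by rewrite !inE eqxx andbF.
  by rewrite !inE eqxx.
rewrite mulnC -tA -tB -tE0; apply: ray.
  by rewrite -BE0 subsetUr.
by rewrite disjoints_subset; apply/subsetP=> e eA; rewrite in_setC in_setD eA.
Qed.

(** The nonadjacent case is applied after dropping the edge [uv]. This changes only the count on
    [W], by the trees through [uv]; [w] and [x] remain as neighbours of [u] and [v]. *)
Lemma trees_vertex_step E W u v w x : two_sets E -> u \in W -> v \in W -> u != v ->
  w \in nbrs E W u -> w != v -> x \in nbrs E W v -> x != u ->
  #|trees E (W :\ u :\ v)| * #|trees E W| <=
  #|trees E (W :\ u)| * #|trees E (W :\ v)|
  + #|trees E (W :\ u :\ v)| * #|[set F in trees E W | [set v; u] \in F]|.
Proof.
move=> E2 uW vW uv wN wv xN xu.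
pose E' := E :\: [set [set u; v]].
have E'2 : two_sets E' by apply: two_setsS E2; apply: subsetDl.
have dropE W' : ~~ ([set u; v] \subset W') -> trees E' W' = trees E W'.
  move=> nW; apply: trees_setD => e; rewrite in_set1 => /eqP->.
  by rewrite (negbTE nW).
have sub2 W' : ([set u; v] \subset W') = (u \in W') && (v \in W').
  by rewrite subUset !sub1set.
have split_uv : #|trees E W| = #|trees E' W| + #|[set F in trees E W | [set v; u] \in F]|.
  rewrite -(cardsID [set F : {set {set T}} | [set v; u] \in F] (trees E W)) addnC; congr (_ + _).
    apply: eq_card => F; rewrite in_setD in_set [X in _ && X]in_set [RHS]in_set.
    rewrite subsetD1 setUC; case: (F \subset E) => //=; rewrite ?andbF //.
  by apply: eq_card => F; rewrite in_setI [RHS]in_set [X in _ && X]in_set.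
rewrite split_uv mulnDr leq_add2r.
have := @trees_vertex_rayleigh E' W u v w x E'2 uW vW uv.
rewrite (dropE (W :\ u :\ v)) ?(dropE (W :\ u)) ?(dropE (W :\ v));
  try by rewrite sub2 !inE !eqxx /= ?andbF.
apply.
- by rewrite in_setD in_set1 eqxx.
- move: wN; rewrite in_set => /andP[wW uwE]; rewrite in_set in_setD in_set1 wW uwE andbT /=.
  by apply: contra wv => /eqP/set2_inj[[_ ->]|[-> ->]].
move: xN; rewrite in_set => /andP[xW vxE]; rewrite in_set in_setD in_set1 xW vxE andbT /=.
by apply: contra xu => /eqP/set2_inj[[-> ->]|[_ ->]].
Qed.

(** The prescribed leaves are pruned one at a time, with a root [r] outside [S]. *)
Lemma leafy_prod E W S r : two_sets E -> S \subset W -> r \in W :\: S ->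
  #|leafy E W S| <= (\prod_(v in S) #|nbrs E setT v|) * #|trees E (W :\: S)|.
Proof.
move=> E2; move En : #|S| => m; elim: m S W En => [|m IH] S W cS SW rWS.
  by move/eqP: cS; rewrite cards_eq0 => /eqP->; rewrite big_set0 mul1n leafy0 setD0.
have [v vS] : exists v, v \in S by apply/card_gt0P; rewrite cS.
move: (rWS); rewrite in_setD => /andP[rS rW].
have vW := subsetP SW v vS.
have rv : r != v by apply: contraNneq rS => ->.
rewrite -{1}(setD1K vS); apply: leq_trans (card_leafy_del (S :\ v) E2 vW rW rv) _.
rewrite (bigD1 v) //= -mulnA; apply: leq_mul.
  by apply/subset_leq_card/subsetP=> y; rewrite !in_set => /andP[_ ->].
have WS : (W :\ v) :\: (S :\ v) = W :\: S.
  apply/setP=> y; rewrite !inE; have [->|_] := eqVneq y v; last by [].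
  by rewrite vS.
rewrite -WS (eq_bigl (mem (S :\ v))) => [|y]; last by rewrite !inE andbC.
apply: IH; first by move: cS; rewrite (cardsD1 v) vS => -[].
  by apply: setSD.
by rewrite WS.
Qed.

End VertexDeletion.

Local Open Scope ring_scope.

(** * The tree ratio under deletion of vertices *)

Section DeletionBounds.

Variables (R : realFieldType) (T : finType) (E : {set {set T}}).
Hypothesis E2 : two_sets E.
Implicit Types (W S : {set T}) (u v : T).

Local Notation tau W := (#|trees E W|%:R : R).

(* Equal to 0 when W carries no tree. *)
Definition tree_ratio W : R := \sum_(v in W) tau (W :\ v) / tau W.

(** This is s_(n-j), indexed by the set of deleted vertices. *)
Definition deleted_trees j : R := \sum_(S : {set T} | #|S| == j) tau (~: S).

Lemma card_trees_del W v : v \in W ->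
  (#|nbrs E W v| * #|trees E (W :\ v)| <= #|trees E W|)%N.
Proof.
move=> vW; have [->|[r rN]] := set_0Vmem (nbrs E W v); first by rewrite cards0.
have rW : r \in W by move: rN; rewrite in_set => /andP[].
rewrite -(card_leafy1 E2 vW rW (nbrs_neq E2 rN)).
by apply/subset_leq_card/subsetP=> F /leafyP[].
Qed.

Lemma card_nbrs_setC S v (m : nat) :
  (m + #|S| <= #|nbrs E setT v|)%N -> (m <= #|nbrs E (~: S) v|)%N.
Proof.
have -> : nbrs E (~: S) v = nbrs E setT v :\: S.
  by apply/setP=> y; rewrite in_setD [LHS]in_set in_setC [y \in nbrs _ _ _]in_set in_setT.
rewrite cardsD leq_subRL; last by apply/subset_leq_card/subsetIl.
rewrite addnC; apply: leq_trans; rewrite leq_add2r.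
exact/subset_leq_card/subsetIr.
Qed.

Lemma tree_ratio_ge0 W : 0 <= tree_ratio W.
Proof. by apply: sumr_ge0 => v _; apply: divr_ge0; apply: ler0n. Qed.

(** Divide [trees_vertex_step] by tau(W - u) tau(W) and sum over v. The error terms add up to at
    most E[deg_T u] / (D - 1), and [sum_deg_trees] gives E[deg_T u] <= 2 |W| / D. *)
Lemma tree_ratio_del W u (D : nat) : (1 < D)%N -> u \in W ->
  (forall v, v \in W -> (D <= #|nbrs E W v|)%N) ->
  tree_ratio (W :\ u) <= tree_ratio W + (2 * #|W|)%:R / (D * D.-1)%:R.
Proof.
move=> D1 uW minD.
have D0 : (0 < D)%N by apply: ltnW.
have D1' : (0 < D.-1)%N by rewrite -subn1 subn_gt0.
(* Here the left side is 0 by the convention for division by 0. *)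
have [tu0|tu_gt0] := posnP #|trees E (W :\ u)|.
  rewrite /tree_ratio big1 => [|v _]; last by rewrite tu0 invr0 mulr0.
  by rewrite addr_ge0 ?tree_ratio_ge0 // divr_ge0 ?ler0n.
have other v y : v \in W -> exists2 w, w \in nbrs E W v & w != y.
  move=> vW; have : (0 < #|nbrs E W v :\ y|)%N.
    by have := minD v vW; rewrite (cardsD1 y); case: (_ \in _); lia.
  by case/card_gt0P=> w; rewrite !inE => /andP[wy wN]; exists w => //; rewrite in_set.
have tW_gt0 : (0 < #|trees E W|)%N.
  apply: leq_trans (card_trees_del uW); rewrite muln_gt0 tu_gt0 andbT.
  exact: leq_trans D0 (minD u uW).
have term v : v \in W :\ u -> tau (W :\ u :\ v) / tau (W :\ u) <=
    tau (W :\ v) / tau W + #|[set F in trees E W | [set v; u] \in F]|%:R / tau W / D.-1%:R.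
  rewrite in_setD1 => /andP[vu vW]; have uv : u != v by rewrite eq_sym.
  have [w wN wv] := other u v uW; have [x xN xu] := other v u vW.
  have := trees_vertex_step E2 uW vW uv wN wv xN xu.
  (* At least [D.-1] neighbours of [v] survive the deletion of [u], which bounds the factor tau(W -
     u - v) of the error term. *)
  have : (D.-1 * #|trees E (W :\ u :\ v)| <= #|trees E (W :\ u)|)%N.
    have vWu : v \in W :\ u by rewrite in_setD1 vu.
    apply: leq_trans (card_trees_del vWu).
    rewrite leq_mul2r; apply/orP; right.
    have -> : nbrs E (W :\ u) v = nbrs E W v :\ u.
      by apply/setP=> y; rewrite in_set !in_setD1 in_set andbA.
    have := minD v vW; rewrite (cardsD1 u) -subn1; lia.
  set a := #|trees E (W :\ u :\ v)|; set b := #|trees E (W :\ u)| in tu_gt0 *.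
  set c := #|trees E (W :\ v)|; set t := #|trees E W| in tW_gt0 *.
  set p := #|[set F in _ | _]|; rewrite -2!(ler_nat R) natrD !natrM => h1 h2.
  have bR : 0 < b%:R :> R by rewrite ltr0n.
  have tR : 0 < t%:R :> R by rewrite ltr0n.
  have dR : 0 < D.-1%:R :> R by rewrite ltr0n.
  rewrite ler_pdivrMr // mulrDl -(ler_pM2r tR) -(ler_pM2r dR).
  have -> : (c%:R / t%:R * b%:R + p%:R / t%:R / D.-1%:R * b%:R) * t%:R * D.-1%:R
     = (b%:R * c%:R) * D.-1%:R + p%:R * b%:R :> R.
    by field; rewrite !gt_eqF.
  have pR : 0 <= p%:R :> R by apply: ler0n.
  have := ler_wpM2r pR h1; have := ler_wpM2r (ltW dR) h2; lra.
rewrite /tree_ratio; apply: le_trans; first by apply: ler_sum => v vW; exact: term vW.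
rewrite big_split /= lerD //.
  rewrite [X in _ <= X](bigD1 u) //= (eq_bigl (fun v => (v \in W) && (v != u))); last first.
    by move=> v; rewrite in_setD1 andbC.
  by rewrite lerDr divr_ge0 ?ler0n.
rewrite -mulr_suml -mulr_suml -natr_sum.
have DR : 0 < D%:R :> R by rewrite ltr0n.
have dR : 0 < D.-1%:R :> R by rewrite ltr0n.
have tR : 0 < tau W by rewrite ltr0n.
rewrite [(D * _)%:R]natrM -(ler_pM2r DR) -(ler_pM2r dR) -(ler_pM2r tR).
set q := (\sum_(v in _) _)%N.
have -> : q%:R / tau W / D.-1%:R * D%:R * D.-1%:R * tau W = (D * q)%:R.
  by rewrite natrM; field; rewrite !gt_eqF.
have -> : (2 * #|W|)%:R / (D%:R * D.-1%:R) * D%:R * D.-1%:R * tau W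
    = (2 * #|W| * #|trees E W|)%:R.
  by rewrite [in RHS]natrM; field; rewrite !gt_eqF.
rewrite ler_nat; apply: leq_trans (sum_deg_trees E2 uW minD).
rewrite leq_mul2l; apply/orP; right; rewrite [X in (_ <= X)%N](bigD1 u) //=.
rewrite /q (eq_bigl (fun v => (v \in W) && (v != u))) ?leq_addl // => v.
by rewrite in_setD1 andbC.
Qed.

(** The vertices are deleted one by one; the margin [k] leaves every vertex at least [D] neighbours
    throughout. *)
Lemma tree_ratio_setC S (D k : nat) : (1 < D)%N -> (#|S| <= k)%N ->
  (forall v, (D + k <= #|nbrs E setT v|)%N) ->
  tree_ratio (~: S) <= tree_ratio setT + #|S|%:R * ((2 * #|T|)%:R / (D * D.-1)%:R).
Proof.
move=> D1; move En : #|S| => m; elim: m S En => [|m IH] S cS mk minD.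
  by move/eqP: cS; rewrite cards_eq0 => /eqP->; rewrite setC0 mul0r addr0.
have [u uS] : exists u, u \in S by apply/card_gt0P; rewrite cS.
have cSu : #|S :\ u| = m by move: cS; rewrite (cardsD1 u) uS => -[].
have := IH _ cSu (ltnW mk) minD.
have SE : ~: S = (~: (S :\ u)) :\ u.
  by apply/setP=> v; rewrite !inE; have [->|] := eqVneq v u; rewrite ?uS.
have uW : u \in ~: (S :\ u) by rewrite !inE eqxx.
have minD' v : v \in ~: (S :\ u) -> (D <= #|nbrs E (~: (S :\ u)) v|)%N.
  move=> _; apply: card_nbrs_setC; apply: leq_trans (minD v).
  by rewrite leq_add2l cSu ltnW.
have := tree_ratio_del D1 uW minD'; rewrite -SE => step ih.
apply: le_trans step _; rewrite -natr1 mulrDl mul1r addrA lerD //.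
rewrite ler_pM2r; last by rewrite invr_gt0 ltr0n muln_gt0 -subn1 subn_gt0 D1 ltnW.
by rewrite ler_nat leq_mul2l max_card.
Qed.

(** Each set of size [j.+1] arises from [j.+1] pairs, one for each choice of its last element
    [v]. *)
Lemma sum_card_setU1 (g : {set T} -> R) j :
  \sum_(S : {set T} | #|S| == j) \sum_(v in ~: S) g (v |: S)
  = j.+1%:R * \sum_(S : {set T} | #|S| == j.+1) g S.
Proof.
have -> : j.+1%:R * \sum_(S : {set T} | #|S| == j.+1) g S
    = \sum_(S : {set T} | #|S| == j.+1) \sum_(v in S) g S.
  rewrite mulr_sumr; apply: eq_bigr => S /eqP cS.
  by rewrite sumr_const cS mulr_natl.
rewrite (exchange_big_dep predT) //= [RHS](exchange_big_dep predT) //=.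
apply: eq_bigr => v _.
rewrite [RHS](reindex_onto (fun S => v |: S) (fun S => S :\ v)) /=; last first.
  by move=> S /andP[_ vS]; rewrite setD1K.
apply: eq_bigl => S; rewrite in_setC setU11 andbT.
have [vS|vS] := boolP (v \in S); rewrite ?andbF ?andbT /=.
  by rewrite andbC; case: eqP => //= SE; rewrite -SE setD11 in vS.
by rewrite setU1K // eqxx andbT cardsU1 vS add1n eqSS.
Qed.

End DeletionBounds.

(** Convexity of the power function: the inductive step leaves the remainder (m+1) z^m (y - z)^2. *)
Lemma tangent_power (R : realFieldType) (y z : R) m : 0 <= y -> 0 <= z ->
  z ^+ m.+1 + m.+1%:R * z ^+ m * (y - z) <= y ^+ m.+1.
Proof.
move=> y0 z0; elim: m => [|m IH]; first by rewrite !expr1 expr0 mulr1 mul1r addrC subrK.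
rewrite (exprS y); apply: le_trans (ler_wpM2l y0 IH); rewrite -subr_ge0.
have -> : y * (z ^+ m.+1 + m.+1%:R * z ^+ m * (y - z)) -
    (z ^+ m.+2 + m.+2%:R * z ^+ m.+1 * (y - z)) = m.+1%:R * z ^+ m * (y - z) ^+ 2.
  by rewrite -[m.+2%:R]natr1 !exprS; ring.
by apply: mulr_ge0; [apply: mulr_ge0; [apply: ler0n|apply: exprn_ge0]|apply: sqr_ge0].
Qed.

(** * Bounds for the number of trees missing k vertices *)

Section DeletedTrees.

Variables (R : realFieldType) (T : finType) (E : {set {set T}}).
Hypothesis E2 : two_sets E.
Implicit Types (W S : {set T}) (u v : T) (F : {set {set T}}).

Local Notation tau W := (#|trees E W|%:R : R).
Local Notation d v := #|nbrs E setT v|.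

Lemma sum_trees_del W : (forall v, v \in W -> (0 < #|nbrs E W v|)%N) ->
  \sum_(v in W) tau (W :\ v) = tau W * tree_ratio R E W.
Proof.
move=> minD; rewrite /tree_ratio mulr_sumr; apply: eq_bigr => v vW.
(* Without a tree on [W] there is none on W - v, since it could be extended by [v]; so the default
   value 0 of the ratio is correct. *)
have [tW|tW] := posnP #|trees E W|.
  have := card_trees_del E2 vW; rewrite tW leqn0 muln_eq0 -leqn0 leqNgt minD //=.
  by move=> /eqP->; rewrite mul0r.
by rewrite mulrC mulfVK // pnatr_eq0 -lt0n.
Qed.

Lemma deleted_trees0 : deleted_trees R E 0 = tau setT.
Proof.
rewrite /deleted_trees (eq_bigl (pred1 set0)) => [|S]; last by rewrite cards_eq0.
by rewrite big_pred1_eq setC0.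
Qed.

Lemma deleted_trees1 : deleted_trees R E 1 = \sum_v tau (setT :\ v).
Proof.
have := @sum_card_setU1 R T (fun S => tau (~: S)) 0.
rewrite mul1r /deleted_trees => <-.
rewrite (eq_bigl (pred1 set0)) => [|S]; last by rewrite cards_eq0.
rewrite big_pred1_eq setC0; apply: eq_big => v; first by rewrite in_setT.
by rewrite setU0 setTD.
Qed.

(** Passing from j to j + 1 deleted vertices multiplies j! s_(n-j) by an average of the ratios on V
    - S with |S| = j, each at most [b]. *)
Lemma deleted_trees_upper (D k : nat) : (1 < D)%N ->
  (forall v, (D + k <= d v)%N) ->
  deleted_trees R E k * k`!%:R <=
  tau setT * (tree_ratio R E setT + k%:R * ((2 * #|T|)%:R / (D * D.-1)%:R)) ^+ k.
Proof.
move=> D1 minD; set h := _ / _; set b := _ + _.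
have h0 : 0 <= h by rewrite divr_ge0 ?ler0n.
suff main j : (j <= k)%N -> deleted_trees R E j * j`!%:R <= tau setT * b ^+ j.
  exact: main.
elim: j => [_|j IH jk]; first by rewrite deleted_trees0 fact0 expr0 mulr1.
have {}IH := IH (ltnW jk).
have -> : deleted_trees R E j.+1 * j.+1`!%:R = (j.+1%:R * deleted_trees R E j.+1) * j`!%:R.
  by rewrite factS natrM; ring.
rewrite {1}/deleted_trees -(sum_card_setU1 (fun S => tau (~: S))).
rewrite exprSr mulrA; apply: (@le_trans _ _ (deleted_trees R E j * b * j`!%:R)).
  rewrite ler_wpM2r ?ler0n // /deleted_trees mulr_suml; apply: ler_sum => S /eqP cS.
  have minS v : (D <= #|nbrs E (~: S) v|)%N.
    by apply: card_nbrs_setC; apply: leq_trans (minD v); rewrite leq_add2l cS ltnW.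
  rewrite (eq_bigr (fun v => tau ((~: S) :\ v))) => [|v _]; last by rewrite setCU setIC -setDE.
  rewrite sum_trees_del => [|v _]; last by apply: leq_trans (minS v); apply: ltnW.
  rewrite ler_wpM2l ?ler0n //; apply: le_trans (tree_ratio_setC R E2 D1 _ minD) _.
    by rewrite cS ltnW.
  by rewrite lerD2l ler_wpM2r // ler_nat cS ltnW.
rewrite mulrAC ler_wpM2r // addr_ge0 ?tree_ratio_ge0 // mulr_ge0 ?ler0n //.
Qed.

(** * The lower bound from leaf weights *)

Section LowerBound.

Variables (k : nat) (w : R).
Hypothesis kT : (k < #|T|)%N.
Hypothesis d_gt0 : forall v, (0 < d v)%N.
Hypothesis d_w : forall v, (d v)%:R^-1 <= w.

Let wt v : R := (d v)%:R^-1.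
Let leaves F := [set v | (deg F v <= 1)%N].
Let X F := \sum_(v in leaves F) wt v.
Let elem_sym F j := \sum_(S : {set T} | #|S| == j)
  (if S \subset leaves F then \prod_(v in S) wt v else 0).

Let wt_ge0 v : 0 <= wt v.
Proof. by rewrite invr_ge0 ler0n. Qed.

Let w_ge0 : 0 <= w.
Proof.
have /card_gt0P[v _] : (0 < #|T|)%N by apply: leq_ltn_trans kT.
exact: le_trans (wt_ge0 v) (d_w v).
Qed.

Let elem_sym_ge0 F j : 0 <= elem_sym F j.
Proof. by apply: sumr_ge0 => S _; case: ifP => // _; apply: prodr_ge0. Qed.

(* The leaves in S contribute at most j w to X F. *)
Let elem_sym_step F j : elem_sym F j * (X F - j%:R * w) <= j.+1%:R * elem_sym F j.+1.
Proof.
rewrite -sum_card_setU1 /elem_sym mulr_suml; apply: ler_sum => S /eqP cS.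
case: ifP => SL; last first.
  by rewrite mul0r; apply: sumr_ge0 => v _; case: ifP => // _; apply: prodr_ge0.
have -> : \sum_(v in ~: S) (if v |: S \subset leaves F then \prod_(i in v |: S) wt i else 0)
    = \prod_(v in S) wt v * \sum_(v in leaves F :\: S) wt v.
  rewrite mulr_sumr [RHS]big_mkcond [LHS]big_mkcond; apply: eq_bigr => v _.
  rewrite in_setC in_setD; case: (boolP (v \in S)) => //= vS.
  rewrite subUset SL andbT sub1set; case: ifP => // _.
  by rewrite big_setU1 //= mulrC.
apply: ler_wpM2l; first exact: prodr_ge0.
rewrite /X (big_setID S) /= addrAC gerDr subr_le0.
have /setIidPr -> := SL.
by rewrite -cS mulr_natl -sumr_const; apply: ler_sum => v _; apply: d_w.
Qed.

(** Iterate [elem_sym_step], whose factor X - j w is at least X - k w >= 0. *)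
Let elem_sym_power F j : k%:R * w <= X F -> (j <= k)%N ->
  (X F - k%:R * w) ^+ j <= j`!%:R * elem_sym F j.
Proof.
move=> kX; have y0 : 0 <= X F - k%:R * w by rewrite subr_ge0.
elim: j => [_|j IH jk].
  rewrite expr0 fact0 mul1r /elem_sym (eq_bigl (pred1 set0)) => [|S].
    by rewrite big_pred1_eq sub0set big_set0.
  by rewrite cards_eq0.
rewrite factS natrM mulrAC [j.+1%:R * _]mulrC; rewrite exprSr.
have step : (X F - k%:R * w) * elem_sym F j <= j.+1%:R * elem_sym F j.+1.
  apply: le_trans (elem_sym_step F j); rewrite mulrC ler_wpM2l ?elem_sym_ge0 //.
  by rewrite lerD2l lerN2 ler_wpM2r ?w_ge0 // ler_nat ltnW.
have f0 : 0 <= j`!%:R :> R by apply: ler0n.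
have := ler_wpM2r y0 (IH (ltnW jk)); have := ler_wpM2l f0 step; lra.
Qed.

(* The tangent of (x - k w)^k at x = b. *)
Let elem_sym_tangent F b : k%:R * w <= b ->
  (b - k%:R * w) ^+ k + k%:R * (b - k%:R * w) ^+ k.-1 * (X F - b)
    <= k`!%:R * elem_sym F k.
Proof.
move=> kb; have z0 : 0 <= b - k%:R * w by rewrite subr_ge0.
have [kX|Xk] := leP (k%:R * w) (X F).
  apply: le_trans (elem_sym_power kX (leqnn k)).
  case: (k) kX z0 => [|m] kX z0; first by rewrite !expr0 !mul0r addr0.
  have -> : X F - b = (X F - m.+1%:R * w) - (b - m.+1%:R * w) by ring.
  by apply: tangent_power; rewrite // subr_ge0.
(* For X < k w the tangent is nonpositive: with k = m + 1 it is -m z^(m+1) plus a nonpositive term.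
   For k = 0 the case is empty, as X >= 0. *)
apply: le_trans (_ : 0 <= _); last by rewrite mulr_ge0 ?ler0n ?elem_sym_ge0.
move: Xk z0; case: (k) => [|m] Xk z0.
  by move: Xk; rewrite mul0r ltNge sumr_ge0.
rewrite exprSr /=; set z := b - _ in z0 *; set q := z ^+ m.
have q0 : 0 <= q by apply: exprn_ge0.
have -> : X F - b = (X F - m.+1%:R * w) - z by rewrite /z; ring.
have qz : 0 <= q * z by apply: mulr_ge0.
have m0 : 0 <= m%:R :> R by apply: ler0n.
have := mulr_ge0 m0 qz; have : 0 <= m.+1%:R * q by rewrite mulr_ge0 ?ler0n.
move=> mq; have : m.+1%:R * q * (X F - m.+1%:R * w) <= 0.
  by rewrite mulr_ge0_le0 // subr_le0 ltW.
by rewrite mulrBr -{3}natr1; lra.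
Qed.

Lemma sum_leaf_weights :
  \sum_(F in trees E setT) X F = \sum_v tau (setT :\ v).
Proof.
rewrite /X (exchange_big_dep predT) //=; apply: eq_bigr => v _.
have [r rN] : exists r, r \in nbrs E setT v by apply/card_gt0P/d_gt0.
have := card_leafy1 E2 (in_setT v) (in_setT r) (nbrs_neq E2 rN).
have -> : #|leafy E setT [set v]| = #|[set F in trees E setT | v \in leaves F]|.
  apply: eq_card => F; rewrite [RHS]in_set [v \in leaves F]in_set.
  apply/leafyP/andP=> [[-> h]|[-> h]]; first by rewrite h ?in_set1.
  by split=> // s; rewrite in_set1 => /eqP->.
move=> cE; rewrite sumr_const -[X in _ *+ X]/(#|_|).
have -> : #|[pred i in trees E setT | v \in leaves i]|
    = (d v * #|trees E (setT :\ v)|)%N.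
  by rewrite -cE; apply: eq_card => F; rewrite [RHS]in_set.
by rewrite -(mulr_natr (wt v)) natrM mulrA mulVf ?mul1r // pnatr_eq0 -lt0n d_gt0.
Qed.

(** The tangent is taken at the mean [b] of X over all trees, so its linear term cancels in the sum.
    By [leafy_prod] each set S contributes at most tau(V - S) to the sum of [elem_sym]. *)
Lemma deleted_trees_lower : k%:R * w <= tree_ratio R E setT ->
  tau setT * (tree_ratio R E setT - k%:R * w) ^+ k <= deleted_trees R E k * k`!%:R.
Proof.
set b := tree_ratio _ _ _ => kb.
have sumX : \sum_(F in trees E setT) X F = tau setT * b.
  rewrite sum_leaf_weights -sum_trees_del; last by move=> v _; apply: d_gt0.
  by apply: eq_bigl => v; rewrite in_setT.
have sum_elem_sym : \sum_(F in trees E setT) elem_sym F k <= deleted_trees R E k.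
  rewrite /elem_sym exchange_big /=; apply: ler_sum => S /eqP cS.
  have [r rS] : exists r, r \in setT :\: S.
    by apply/card_gt0P; rewrite setTD cardsCs setCK subn_gt0 cS.
  have := leafy_prod E2 (subsetT S) rS; rewrite setTD -(ler_nat R) natrM natr_prod => le.
  rewrite -big_mkcondr sumr_const.
  have -> : #|[pred F in trees E setT | S \subset leaves F]| = #|leafy E setT S|.
    apply: eq_card => F; rewrite [RHS]in_set.
    rewrite -[LHS]/((F \in trees E setT) && (S \subset leaves F)); congr (_ && _).
    apply/subsetP/forall_inP=> h s sS; first by have := h s sS; rewrite in_set.
    by rewrite in_set; apply: h.
  have p0 : 0 < \prod_(v in S) (d v)%:R :> R by apply: prodr_gt0 => v _; rewrite ltr0n.
  by rewrite /wt prodfV -(mulr_natr (_^-1)) mulrC ler_pdivrMr // mulrC.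
have : \sum_(F in trees E setT)
   ((b - k%:R * w) ^+ k + k%:R * (b - k%:R * w) ^+ k.-1 * (X F - b))
   <= \sum_(F in trees E setT) k`!%:R * elem_sym F k.
  by apply: ler_sum => F _; apply: elem_sym_tangent.
rewrite big_split /= -!mulr_sumr sumrB sumX !sumr_const -[b *+ _]mulr_natl subrr mulr0 addr0.
rewrite -[X in X <= _]mulr_natl => h; apply: le_trans h _.
by rewrite mulrC ler_wpM2r // ler0n.
Qed.

End LowerBound.

End DeletedTrees.

(** * Elementary bounds for powers *)

Lemma bernoulli_le1 (R : realFieldType) (x : R) k :
  0 <= x -> x <= 1 -> 1 - k%:R * x <= (1 - x) ^+ k.
Proof.
move=> x0 x1; elim: k => [|k IH]; first by rewrite expr0 mul0r subr0.
have x1' : 0 <= 1 - x by rewrite subr_ge0.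
rewrite exprSr; apply: le_trans (ler_wpM2r x1' IH).
have : 0 <= k%:R * (x * x) by rewrite !mulr_ge0 ?ler0n.
by rewrite -[k.+1%:R]natr1; lra.
Qed.

(** From (1 + y)^k (1 - y)^k <= 1 and Bernoulli, (1 + y)^k <= 1 / (1 - z) with z = k y, and this is
    at most 1 + 2 z for z <= 1/2. *)
Lemma power_add1_le (R : realFieldType) (y : R) k :
  0 <= y -> k%:R * y <= 2^-1 -> (1 + y) ^+ k <= 1 + 2 * (k%:R * y).
Proof.
move=> y0 ky; case: k ky => [|k] ky; first by rewrite expr0 mul0r mulr0 addr0.
have y1 : y <= 1.
  have : 0 <= k%:R * y by rewrite mulr_ge0 ?ler0n.
  by move: ky; rewrite -[k.+1%:R]natr1 mulrDl; lra.
have low := bernoulli_le1 k.+1 y0 y1.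
have z0 : 0 <= k.+1%:R * y by rewrite mulr_ge0 ?ler0n.
set z := k.+1%:R * y in ky low z0 *; set p := (1 + y) ^+ k.+1.
have p0 : 0 <= p by rewrite exprn_ge0 // addr_ge0.
have pq : p * (1 - y) ^+ k.+1 <= 1.
  rewrite -exprMn exprn_ile1 //; first by rewrite mulr_ge0; lra.
  by rewrite -subr_ge0 (_ : _ - _ = y * y) ?mulr_ge0 //; ring.
have p1 : p * (1 - z) <= 1 by apply: le_trans pq; apply: ler_wpM2l.
have z1 : 0 < 1 - z by lra.
rewrite -(ler_pM2r z1); apply: le_trans p1 _.
have : 0 <= z * (1 - 2 * z) by rewrite mulr_ge0; lra.
lra.
Qed.

(** * The estimate *)

Section CoreEstimate.

Variables (R : realFieldType) (T : finType) (E : {set {set T}}).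
Hypothesis E2 : two_sets E.

Local Notation tau W := (#|trees E W|%:R : R).
Local Notation d v := #|nbrs E setT v|.
Local Notation beta := (tree_ratio R E setT).

(** Each leaf has weight at least 1 / n, and [leafy_lower] gives at least (D - 2) / 7 leaves on
    average. *)
Lemma tree_ratio_lower (D : nat) : (0 < D)%N -> (forall v, (D <= d v)%N) ->
  (0 < #|T|)%N -> (0 < #|trees E setT|)%N -> (D%:R - 2) / (7 * #|T|%:R) <= beta.
Proof.
move=> D0 minD T0 t0.
have T0' : [set: T] != set0 by rewrite -card_gt0 cardsT.
have := leafy_lower E2 T0' (fun v _ => minD v).
have : (\sum_(v in setT) #|leafy E setT [set v]| <=
    #|T| * \sum_(v in setT) #|trees E (setT :\ v)|)%N.
  rewrite big_distrr /=; apply: leq_sum => v _.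
  have [r rN] : exists r, r \in nbrs E setT v.
    by apply/card_gt0P; apply: leq_trans D0 (minD v).
  rewrite (card_leafy1 E2 (in_setT v) (in_setT r) (nbrs_neq E2 rN)).
  by rewrite leq_mul2r max_card orbT.
have := @sum_trees_del R T E E2 setT.
move=> /(_ (fun v _ => leq_trans D0 (minD v))); rewrite -natr_sum.
set s := (\sum_(v in _) #|trees E _|)%N; set l := (\sum_(v in _) #|leafy E _ _|)%N.
set m := #|T| in T0 *; set t := #|trees E setT| in t0 *; set b := beta.
move=> sE; rewrite -2!(ler_nat R) !natrD !natrM sE => h1 h2.
have tR : 0 < t%:R :> R by rewrite ltr0n.
have mR : 0 < m%:R :> R by rewrite ltr0n.
rewrite ler_pdivrMr ?mulr_gt0 // -(ler_pM2l tR).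
have -> : t%:R * (b * (7 * m%:R)) = 7 * (m%:R * (t%:R * b)) by ring.
lra.
Qed.

(** Here t = n^(1/3). With beta >= a / 14, w = 1 / (a n) and h <= 8 / (a^2 n), the relative errors x
    = k w / beta and y = k h / beta are at most 14 k / (a^2 n) and 112 k / (a^3 n). The lower bounds
    on t ensure x <= 1 and k y <= 1/2. *)
Lemma deleted_trees_estimate (a t : R) (k delta : nat) :
  0 < a -> 2 <= t -> 14 / a ^+ 2 <= t -> 224 / a ^+ 3 <= t -> 8 / a <= t ->
  #|T|%:R = t ^+ 3 -> k%:R <= t -> a * t ^+ 3 <= delta%:R ->
  (forall v, (delta <= d v)%N) -> (0 < #|trees E setT|)%N ->
  `| deleted_trees R E k / tau setT - beta ^+ k / k`!%:R |
    <= (14 / a ^+ 2 + 224 / a ^+ 3) * k%:R / t * (beta ^+ k / k`!%:R).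
Proof.
move=> a0 t2 ta2 ta3 ta1 nE kt ad minD t0.
have tp : 0 < t by lra.
have tt : t <= t ^+ 2 by rewrite expr2 ler_peMl; lra.
have t3 : t ^+ 2 <= t ^+ 3 by rewrite [t ^+ 3]exprS ler_peMl ?exprn_ge0; lra.
have at8 : 8 <= a * t by move: ta1; rewrite ler_pdivrMr // mulrC.
have at3 : 8 * t ^+ 2 <= a * t ^+ 3.
  by rewrite [t ^+ 3]exprS mulrA ler_wpM2r ?exprn_ge0 // ltW.
have n0 : (0 < #|T|)%N by rewrite -(ltr0n R) nE exprn_gt0.
have kT : (k < #|T|)%N by rewrite -(ltr_nat R) nE; apply: le_lt_trans kt _; nra.
have dR : 16 <= delta%:R :> R by lra.
have kd : (k + 2 <= delta)%N by rewrite -(ler_nat R) natrD; lra.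
pose D := (delta - k)%N.
have D1 : (1 < D)%N by rewrite /D; move: kd; clear; lia.
have Dk v : (D + k <= d v)%N by apply: leq_trans (minD v); rewrite /D; move: kd; clear; lia.
have DE : D%:R = delta%:R - k%:R :> R by rewrite natrB //; move: kd; clear; lia.
have D1E : D.-1%:R = delta%:R - k%:R - 1 :> R.
  by rewrite -DE -subn1 natrB // ltnW.
have b_low : a / 14 <= beta.
  have d0 : (0 < delta)%N by move: kd; clear; lia.
  have := tree_ratio_lower d0 minD n0 t0.
  rewrite nE; apply: le_trans; rewrite ler_pdivlMr ?mulr_gt0 ?exprn_gt0 //.
  lra.
have a14 : 0 < a / 14 by rewrite divr_gt0.
have b0 : 0 < beta by apply: lt_le_trans b_low.
have n3 : 0 < t ^+ 3 by apply: exprn_gt0.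
have k0 : 0 <= k%:R :> R by apply: ler0n.
pose w : R := (a * t ^+ 3)^-1.
have w0 : 0 <= w by rewrite invr_ge0 mulr_ge0 // ltW.
have d_w v : (d v)%:R^-1 <= w.
  rewrite lef_pV2 ?posrE ?mulr_gt0 //; last first.
    by rewrite ltr0n; apply: leq_trans (minD v); move: kd; clear; lia.
  by apply: le_trans ad _; rewrite ler_nat.
have d_gt0 v : (0 < d v)%N by apply: leq_trans (minD v); move: kd; clear; lia.
pose h : R := (2 * #|T|)%:R / (D * D.-1)%:R.
have h0 : 0 <= h by rewrite divr_ge0 ?ler0n.
have h8 : h <= 8 / (a ^+ 2 * t ^+ 3).
  (* Since k <= t is small against a n, at least half of the degree bound a n survives the
     deletions. *)
  have half : a * t ^+ 3 / 2 <= D.-1%:R by rewrite D1E; lra.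
  have half' : a * t ^+ 3 / 2 <= D%:R by apply: le_trans half _; rewrite ler_nat leq_pred.
  have at0 : 0 < a * t ^+ 3 / 2 by rewrite divr_gt0 ?mulr_gt0.
  have DD : (a * t ^+ 3 / 2) * (a * t ^+ 3 / 2) <= (D * D.-1)%:R.
    by rewrite natrM ler_pM // ltW.
  rewrite /h natrM nE ler_pdivrMr; last by apply: lt_le_trans DD; apply: mulr_gt0.
  have c0 : 0 <= 8 / (a ^+ 2 * t ^+ 3) by rewrite divr_ge0 ?mulr_ge0 ?exprn_ge0 // ltW.
  apply: le_trans (ler_wpM2l c0 DD); rewrite le_eqVlt; apply/orP; left; apply/eqP.
  by field; rewrite !gt_eqF.
pose x := k%:R * w / beta; pose y := k%:R * h / beta.
have binv : beta^-1 <= 14 / a.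
  by rewrite -[14 / a]invf_div lef_pV2 // posrE.
have bi0 : 0 <= beta^-1 by rewrite invr_ge0 ltW.
have x0 : 0 <= x by rewrite divr_ge0 ?mulr_ge0 // ltW.
have y0 : 0 <= y by apply: divr_ge0 (ltW b0); apply: mulr_ge0.
have kn : k%:R / t ^+ 3 <= t^-1 * t^-1.
  rewrite ler_pdivrMr //; apply: le_trans kt _; rewrite le_eqVlt; apply/orP; left.
  by apply/eqP; field; rewrite gt_eqF.
have ti0 : 0 < t^-1 by rewrite invr_gt0.
have ti1 : t^-1 <= 1 by rewrite invf_le1; lra.
have kn0 : 0 <= k%:R / t ^+ 3 by rewrite divr_ge0 // ltW.
have kn1 : k%:R / t ^+ 3 <= t^-1 by apply: le_trans kn _; rewrite ler_piMl // ltW.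
have c2 : 0 < 14 / a ^+ 2 by rewrite divr_gt0 ?exprn_gt0.
have c3 : 0 < 112 / a ^+ 3 by rewrite divr_gt0 ?exprn_gt0.
have xle : x <= 14 / a ^+ 2 * (k%:R / t ^+ 3).
  apply: (@le_trans _ _ (k%:R * w * (14 / a))); first by rewrite ler_wpM2l ?mulr_ge0.
  rewrite le_eqVlt; apply/orP; left; apply/eqP; rewrite /w.
  by field; rewrite !gt_eqF.
have yle : y <= 112 / a ^+ 3 * (k%:R / t ^+ 3).
  apply: (@le_trans _ _ (k%:R * (8 / (a ^+ 2 * t ^+ 3)) * (14 / a))).
    by apply: ler_pM => //; [apply: mulr_ge0|apply: ler_wpM2l].
  rewrite le_eqVlt; apply/orP; left; apply/eqP.
  by field; rewrite !gt_eqF.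
have xt : x <= 14 / a ^+ 2 / t by apply: le_trans xle _; rewrite ler_pM2l.
have yt : y <= 112 / a ^+ 3 / t by apply: le_trans yle _; rewrite ler_pM2l.
have x1 : x <= 1 by apply: le_trans xt _; rewrite ler_pdivrMr // mul1r.
have ky : k%:R * y <= 2^-1.
  apply: (@le_trans _ _ (t * (112 / a ^+ 3 * (t^-1 * t^-1)))).
    apply: ler_pM => //; apply: le_trans yle _; by rewrite ler_pM2l.
  rewrite (_ : t * _ = 112 / a ^+ 3 / t); last by field; rewrite !gt_eqF.
  by rewrite ler_pdivrMr //; lra.
(* The two bounds become beta^k (1 - x)^k and beta^k (1 + y)^k, whose relative deviations are at
   most k x and 2 k y. *)
have xb : beta - k%:R * w = beta * (1 - x) by rewrite /x; field; rewrite gt_eqF.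
have yb : beta + k%:R * h = beta * (1 + y) by rewrite /y; field; rewrite gt_eqF.
have kw : k%:R * w <= beta by rewrite -subr_ge0 xb mulr_ge0 ?subr_ge0 // ltW.
have up := deleted_trees_upper R E2 D1 Dk.
have lo := deleted_trees_lower E2 kT d_gt0 d_w kw.
rewrite -/h yb exprMn in up; rewrite xb exprMn in lo.
have f0 : 0 < k`!%:R :> R by rewrite ltr0n fact_gt0.
have tR : 0 < tau setT by rewrite ltr0n.
have q0 : 0 < beta ^+ k by apply: exprn_gt0.
set s := deleted_trees R E k in up lo *; set q := beta ^+ k in up lo q0 *.
set f := k`!%:R in up lo f0 *; set N := tau setT in up lo tR *.
have -> : s / N - q / f = (s * f - N * q) / (N * f) by field; rewrite !gt_eqF.
rewrite normrM [X in _ * X]ger0_norm ?invr_ge0 ?mulr_ge0 ?(ltW tR) ?(ltW f0) //.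
rewrite ler_pdivrMr ?mulr_gt0 //.
set C := _ / _; have -> : C * (q / f) * (N * f) = C * (N * q).
  by field; rewrite gt_eqF.
have Nq : 0 < N * q by apply: mulr_gt0.
have kx1 : k%:R * x <= C.
  have -> : C = k%:R * (14 / a ^+ 2 / t) + k%:R * (224 / a ^+ 3 / t).
    by rewrite /C; field; rewrite !gt_eqF.
  have : 0 <= k%:R * (224 / a ^+ 3 / t).
    by rewrite mulr_ge0 // !divr_ge0 ?exprn_ge0 // ltW.
  have := ler_wpM2l k0 xt; lra.
have ky1 : 2 * (k%:R * y) <= C.
  have -> : C = k%:R * (14 / a ^+ 2 / t) + 2 * (k%:R * (112 / a ^+ 3 / t)).
    by rewrite /C; field; rewrite !gt_eqF.
  have : 0 <= k%:R * (14 / a ^+ 2 / t).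
    by rewrite mulr_ge0 // !divr_ge0 ?exprn_ge0 // ltW.
  have := ler_wpM2l k0 yt; lra.
have up' := le_trans up (ler_wpM2l (ltW tR) (ler_wpM2l (ltW q0) (power_add1_le y0 ky))).
have lo' := le_trans (ler_wpM2l (ltW tR) (ler_wpM2l (ltW q0) (bernoulli_le1 k x0 x1))) lo.
have := ler_wpM2r (ltW Nq) kx1; have := ler_wpM2r (ltW Nq) ky1.
rewrite ler_norml; lra.
Qed.

End CoreEstimate.

(** * Subtrees of a graph, grouped by vertex set *)

Section GraphTrees.

Variable G : sgraph.

Local Notation E := (edge_set G).

Lemma mem_edge_set (x y : G) : ([set x; y] \in E) = adj x y.
Proof.
rewrite inE; apply/existsP/idP=> [[a /existsP[b /andP[ab /eqP/set2_inj]]]|xy].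
  by case=> -[-> ->] //; rewrite adj_sym.
by exists x; apply/existsP; exists y; rewrite xy eqxx.
Qed.

Lemma two_sets_edge_set : two_sets E.
Proof.
move=> e; rewrite inE => /existsP[x /existsP[y /andP[xy /eqP->]]].
by rewrite cards2; case: eqP xy => // ->; rewrite adj_irrefl.
Qed.

Lemma card_nbrs_edge_set (x : G) : #|nbrs E setT x| = degree x.
Proof. by apply: eq_card => y; rewrite [LHS]in_set in_setT mem_edge_set [RHS]in_set. Qed.

Lemma min_degree_le (x : G) : (min_degree G <= degree x)%N.
Proof.
rewrite /min_degree; elim: (index_enum G) (mem_index_enum x) => //= y s IH.
rewrite inE big_cons => /orP[/eqP<-|/IH le]; first exact: geq_minl.
exact: leq_trans (geq_minr _ _) le.
Qed.

Lemma num_subtrees_sum j :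
  num_subtrees G j = (\sum_(W : {set G} | #|W| == j) #|trees E W|)%N.
Proof.
rewrite (eq_bigl (mem [set W : {set G} | #|W| == j])) => [|W]; last by rewrite /= in_set.
rewrite (card_sum_pairs _ (fun W => trees E W)); apply: eq_card => -[W F].
rewrite [LHS]in_set [RHS]in_set [in RHS]in_set /= andbC; congr (_ && _).
rewrite [RHS]in_set; apply/asboolP/and3P=> [[[/= FE FW] conn acyc]|].
  by split=> //; apply/asboolP.
by case=> FE FW /asboolP[conn acyc]; split.
Qed.

Lemma connected_spanning_tree : connected_graph G -> (0 < #|trees E setT|)%N.
Proof.
move=> [+ conn] => /card_gt0P[r rT].
have [||f rf] := @connected_rooted _ E setT r rT.
- exact: subsetT.
- split=> [|x y xT yT]; first by apply/card_gt0P; exists r.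
  have -> : connect (edge_rel E) x y = connect (@adj G) x y.
    by apply: eq_connect => a b; rewrite /edge_rel mem_edge_set.
  exact: conn.
by apply/card_gt0P; exists (map_edges f); apply: rooted_trees rf.
Qed.

Variable R : realType.

Lemma num_subtrees_deleted k : (k <= #|G|)%N ->
  (num_subtrees G (#|G| - k))%:R = deleted_trees R E k.
Proof.
move=> kn; rewrite num_subtrees_sum natr_sum /deleted_trees.
rewrite (reindex_inj (inv_inj (@setCK _))) /=; apply: eq_bigl => S.
rewrite cardsCs setCK; apply/eqP/eqP=> [h|->//].
have le : (#|S| <= #|G|)%N by apply: max_card.
by rewrite -(subKn le) h subKn.
Qed.

Lemma beta_tree_ratio : connected_graph G -> (forall x : G, (0 < degree x)%N) ->
  beta R G = tree_ratio R E setT.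
Proof.
move=> conn deg0; have t0 := connected_spanning_tree conn.
have [/card_gt0P[r _] _] := conn.
have n0 : (0 < #|G|)%N by apply/card_gt0P; exists r.
rewrite /beta -{2}[#|G|]subn0 -subn1 !num_subtrees_deleted // deleted_trees0 deleted_trees1.
rewrite (eq_bigl (mem [set: G])) => [|v]; last by rewrite /= in_setT.
rewrite sum_trees_del.
- by rewrite mulrC mulKf // pnatr_eq0 -lt0n.
- exact: two_sets_edge_set.
by move=> v _; rewrite card_nbrs_edge_set.
Qed.

End GraphTrees.

(* The asymptotic statement *)
From mathcomp Require Import all_classical all_reals all_analysis.
Import numFieldNormedType.Exports.

Local Open Scope classical_set_scope.

(** The estimate holds with one constant for all k <= n^(1/3), a range that contains those of both
    parts of the theorem for large n. *)
Lemma subtree_estimate_dense (R : realType) (alpha : R) : 0 < alpha ->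
  exists (A : R) (n0 : nat), 0 < A /\
    forall n : nat, (n0 <= n)%N ->
    forall G : sgraph, #|G| = n -> connected_graph G ->
      alpha * n%:R <= (min_degree G)%:R ->
      forall k : nat, k%:R <= n%:R `^ (3^-1 : R) -> subtree_estimate A G k.
Proof.
move=> a0.
(* The sum of the thresholds of [deleted_trees_estimate]; all terms are positive, so [t0 <= t]
   implies each of them. *)
pose t0 : R := 2 + 14 / alpha ^+ 2 + 224 / alpha ^+ 3 + 8 / alpha.
have c1 : 0 < 14 / alpha ^+ 2 by rewrite divr_gt0 ?exprn_gt0.
have c2 : 0 < 224 / alpha ^+ 3 by rewrite divr_gt0 ?exprn_gt0.
have c3 : 0 < 8 / alpha by rewrite divr_gt0.
have t00 : 0 <= t0 by rewrite /t0; lra.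
have [n0 n0P] : exists n0 : nat, t0 ^+ 3 <= n0%:R.
  by exists (Num.truncn (t0 ^+ 3)).+1; rewrite ltW // truncnS_gt.
exists (14 / alpha ^+ 2 + 224 / alpha ^+ 3), n0; split; first lra.
move=> n n0n G Gn conn degG k kt.
pose t : R := n%:R `^ 3^-1.
have t3 : n%:R = t ^+ 3.
  by rewrite -powR_mulrn ?powR_ge0 // -powRrM mulVf ?pnatr_eq0 // powRr1.
have tt0 : t0 <= t.
  rewrite -(@ler_pXn2r _ 3) ?nnegrE ?powR_ge0 // -t3.
  by apply: le_trans n0P _; rewrite ler_nat.
have tp : 0 < t by move: tt0; rewrite /t0; lra.
have n3 : 0 < t ^+ 3 by apply: exprn_gt0.
have deg_gt0 (x : G) : (0 < degree x)%N.
  apply: leq_trans (min_degree_le x); rewrite -(ltr0n R).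
  by apply: lt_le_trans degG; rewrite t3 mulr_gt0.
have kG : (k <= #|G|)%N.
  rewrite Gn -(ler_nat R); apply: le_trans kt _; rewrite -/t t3 exprS ler_peMr ?(ltW tp) //.
  by rewrite exprn_ege1 //; move: tt0; rewrite /t0; lra.
rewrite /subtree_estimate beta_tree_ratio // num_subtrees_deleted //.
rewrite -[X in num_subtrees _ X]subn0 num_subtrees_deleted // deleted_trees0.
rewrite Gn powRN -/t.
apply: (deleted_trees_estimate (@two_sets_edge_set G) a0 (delta := min_degree G)) => //.
- by move: tt0; rewrite /t0; lra.
- by move: tt0; rewrite /t0; lra.
- by move: tt0; rewrite /t0; lra.
- by move: tt0; rewrite /t0; lra.
- by rewrite Gn.
- by rewrite -t3.
- by move=> v; rewrite card_nbrs_edge_set min_degree_le.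
exact: connected_spanning_tree.
Qed.

Theorem theorem2 (R : realType) (alpha : R) (alpha_gt0 : 0 < alpha) :
  (forall k : nat -> nat,
     (k n)%:R / n%:R `^ (3^-1 : R) @[n --> \oo] --> (0 : R) ->
     exists (A : R) (n0 : nat), 0 < A /\
       forall n : nat, (n0 <= n)%N ->
       forall G : sgraph, #|G| = n -> connected_graph G ->
         alpha * n%:R <= (min_degree G)%:R ->
         subtree_estimate A G (k n))
  /\
  (forall eps : R, 0 < eps ->
     exists (A : R) (n0 : nat), 0 < A /\
       forall n : nat, (n0 <= n)%N ->
       forall G : sgraph, #|G| = n -> connected_graph G ->
         alpha * n%:R <= (min_degree G)%:R ->
         forall k : nat, k%:R <= n%:R `^ (3^-1 - eps) ->
           subtree_estimate A G k).
Proof.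
have [A [n0 [A0 est]]] := subtree_estimate_dense alpha_gt0.
(* Convergence with tolerance 1 gives k(n) <= n^(1/3) eventually. Taking n >= 1 makes this power
   positive and, in the second part, monotone in the exponent. *)
split=> [k /cvgrPdist_le /(_ 1 ltr01) [N _ kN]|eps eps0].
  exists A, (maxn 1 (maxn n0 N)); split=> // n.
  rewrite !geq_max => /and3P[n1 n0n Nn] G Gn conn degG.
  apply: (est n) => //; have := kN n Nn.
  have p0 : 0 < n%:R `^ (3^-1 : R) by rewrite powR_gt0 // ltr0n.
  by rewrite /= sub0r normrN ger0_norm ?divr_ge0 ?(ltW p0) // ler_pdivrMr // mul1r.
exists A, (maxn 1 n0); split=> // n; rewrite geq_max => /andP[n1 n0n] G Gn conn degG k kn.
apply: (est n) => //; apply: le_trans kn _; apply: ler_powR; first by rewrite ler1n.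
by rewrite gerBl ltW.
Qed.
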